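(* For every integer $0\le k\le7$ the following hold. (a) $\dim_{\mathbb{Q}}\operatorname{gr}^W_k(\mathcal{Z}_q)$ equals the coefficient of $x^k$ in the power series expansion of $\dfrac{1}{1-x-x^2-x^3+x^6+x^7+x^8+x^9}$. (b) Every bi-bracket of weight $k$ is a $\mathbb{Q}$-linear combination of positive bi-brackets. (c) Every bi-bracket of weight $k$ is a $\mathbb{Q}$-linear combination of brackets. (d) Every bracket of weight $k$ is a $\mathbb{Q}$-linear combination of $123$-brackets.
   Context: For $s_1,\dots,s_l\ge1$, $r_1,\dots,r_l\ge0$ the bi-bracket is $$\begin{bmatrix} s_1,\dots,s_l\\ r_1,\dots,r_l\end{bmatrix}=\sum_{\substack{u_1>\cdots>u_l>0\\ v_1,\dots,v_l>0}}\frac{u_1^{r_1}\cdots u_l^{r_l}}{r_1!\cdots r_l!}\cdot\frac{v_1^{s_1-1}\cdots v_l^{s_l-1}}{(s_1-1)!\cdots(s_l-1)!}\,q^{u_1v_1+\cdots+u_lv_l}\in\mathbb{Q}[[q]]$$ (equal to $1$ for $l=0$); it has depth $l$ and weight $s_1+\cdots+s_l+r_1+\cdots+r_l$. A bracket is $[s_1,\dots,s_l]=\begin{bmatrix} s_1,\dots,s_l\\ 0,\dots,0\end{bmatrix}$. A bi-bracket is positive if $s_j>r_j$ for all $j$. A $123$-bracket is a bracket $[s_1,\dots,s_l]$ with $l\ge0$ and all $s_j\in\{1,2,3\}$. $\mathcal{Z}_q$ is the $\mathbb{Q}$-span of all bi-brackets; $\operatorname{Fil}^W_k(\mathcal{Z}_q)$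 is the $\mathbb{Q}$-span of the bi-brackets of depth $\le k$ and weight $\le k$ (and $\operatorname{Fil}^W_{-1}=0$), and $\operatorname{gr}^W_k(\mathcal{Z}_q)=\operatorname{Fil}^W_k(\mathcal{Z}_q)/\operatorname{Fil}^W_{k-1}(\mathcal{Z}_q)$. *)

(* Defs.v *)
From mathcomp Require Import all_boot all_order all_algebra.

Set Implicit Arguments.
Unset Strict Implicit.
Unset Printing Implicit Defensive.

Import Order.TTheory GRing.Theory Num.Theory.
Local Open Scope ring_scope.

(* A formal power series over rat, given by its sequence of coefficients.
   The linear operations are written out pointwise below. *)
Definition fps := nat -> rat.

(* The coefficient of q^n in the bi-bracket [s_1,...,s_l ; r_1,...,r_l].
   Since all u_j, v_j are positive, \sum_j u_j v_j = n forces u_j, v_j <= n, so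
   letting u_j, v_j range over 'I_n.+1 loses no term of the infinite sum. *)
Definition bibracket (l : nat) (s r : l.-tuple nat) : fps := fun n =>
  \sum_(u : {ffun 'I_l -> 'I_n.+1} |
          [forall j, (0 < u j)%N] &&
          [forall i : 'I_l, forall j : 'I_l, (i < j)%N ==> (u j < u i)%N])
  \sum_(v : {ffun 'I_l -> 'I_n.+1} |
          [forall j, (0 < v j)%N] && (\sum_j u j * v j == n)%N)
  \prod_j ((u j)%:R ^+ tnth r j / (tnth r j)`!%:R
           * ((v j)%:R ^+ (tnth s j).-1 / ((tnth s j).-1)`!%:R)).

Definition bracket (l : nat) (s : l.-tuple nat) : fps :=
  bibracket s [tuple 0%N | _ < l].

(* The requirement s_j >= 1 on the upper row of a bi-bracket. *)
Definition admissible (l : nat) (s : l.-tuple nat) : bool :=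
  [forall j, (1 <= tnth s j)%N].

Definition weight (l : nat) (s r : l.-tuple nat) : nat :=
  (\sum_j tnth s j + \sum_j tnth r j)%N.

Definition bracket_weight (l : nat) (s : l.-tuple nat) : nat :=
  weight s [tuple 0%N | _ < l].

Definition positive_bibrackets (f : fps) : Prop :=
  exists l (s r : l.-tuple nat),
    [/\ admissible s, [forall j, (tnth r j < tnth s j)%N] & f = bibracket s r].

Definition brackets (f : fps) : Prop :=
  exists l (s : l.-tuple nat), admissible s /\ f = bracket s.

Definition brackets123 (f : fps) : Prop :=
  exists l (s : l.-tuple nat),
    [forall j, tnth s j \in [:: 1; 2; 3]%N] /\ f = bracket s.

Definition Qspan (S : fps -> Prop) (f : fps) : Prop :=
  exists m (c : 'I_m -> rat) (g : 'I_m -> fps),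
    (forall i, S (g i)) /\ (forall n, f n = \sum_(i < m) c i * g i n).

(* Indexed by int so that FilW (-1) is meaningful: its spanning set is empty,
   so it is the zero space. *)
Definition FilW (k : int) : fps -> Prop :=
  Qspan (fun f => exists l (s r : l.-tuple nat),
    [/\ admissible s, l%:Z <= k, (weight s r)%:Z <= k & f = bibracket s r]).

(* For subspaces B of A, dim (A / B) = d: there are d elements of A whose
   classes form a basis of A / B. *)
Definition dim_quotient (A B : fps -> Prop) (d : nat) : Prop :=
  exists b : 'I_d -> fps,
    (forall i, A (b i)) /\
    (forall f, A f -> exists! c : {ffun 'I_d -> rat},
       B (fun n => f n - \sum_(i < d) c i * b i n)).

Definition dim_grW (k : int) (d : nat) : Prop :=
  dim_quotient (FilW k) (FilW (k - 1)) d.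

(* a is the power series expansion of N / D, i.e. D * a = N as power series. *)
Definition is_expansion (N D : {poly rat}) (a : fps) : Prop :=
  forall n, \sum_(i < n.+1) D`_i * a (n - i)%N = N`_n.

(* Main.v *)
From HB Require Import structures.
Require Import Defs.
From Stdlib Require Import BinNums BinPos.
From mathcomp Require Import all_boot all_order all_algebra.
From mathcomp Require Import ring lra zify.

Set Implicit Arguments.
Unset Strict Implicit.
Unset Printing Implicit Defensive.

Import Order.TTheory GRing.Theory Num.Theory.
Local Open Scope ring_scope.

(* For a word w = (s_1, ..., s_l) of natural numbers put
     E(w) = sum_(u_1 > ... > u_l > 0) prod_j (q^(u_j) / (1 - q^(u_j)))^(s_j),   s_1 > 0.
   Writing v^(s-1) through the binomials C(v-1, j) and powers of u through
   insertions of the letter 0, every bi-bracket of weight k is a combination of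
   E(w) with sum_j max(s_j, 1) <= k.  Two facts produce relations.  The E(w)
   multiply by the quasi-shuffle product with z_a <> z_b = z_(a+b).  And E(w) is
   invariant under a duality: expanding each power of q^u / (1 - q^u) in a
   geometric series and each u_j as a sum of gaps turns E(w) into the sum of
   q^(sum of n_p m_y over the pairs p before y) over all positive labels of the
   letters of the word p^(s_1) y ... p^(s_l) y, so reversing the word and
   exchanging p and y does not change it.  The products of a with b and of
   (a or its dual) with (b or its dual) therefore agree.  Up to weight 7, the
   top-weight parts of these relations express all words by 92 words with
   letters 1, 2, 3; the 92 q-series are independent.  Both are nonsingularity
   statements for integer matrices, verified modulo 3. *)

(** * Words, quasi-shuffles and duality *)

(** All four claims come from one statement: for k <= 8, the bi-brackets of weight below k span a
    space with basis the words of [basis_words] of weight below k. Words in 1, 2, 3 contain no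
    letter 0, so no power of u arises when they are rewritten, and z^s with s <= 3 needs only
    bracket letters at most s. Basis words are therefore combinations of 123-brackets of no larger
    weight, which closes the circle. The dimension claim becomes a count: 1/(1-x-x^2-x^3) counts
    words in 1, 2, 3 by weight, 96 of them up to weight 7, and x^6 + x^7 in the denominator lowers
    the coefficients by one in degree 6 and by three in degree 7. The obstacle is that the relations
    are not homogeneous: merging a 0 with another letter loses weight. Hence the induction on
    weight, where lower words are already known and only the top-weight part of a relation enters
    the matrix. A matrix with an inverse modulo a prime has nonzero determinant, so a table of
    digits 0, 1, 2 replaces a rational inverse. *)

Fixpoint stuffle (a b : seq nat) {struct a} : seq (seq nat) :=
  if a is x :: a' then
    (fix stuffle_a b := if b is y :: b' then
       [seq x :: w | w <- stuffle a' b] ++ [seq y :: w | w <- stuffle_a b']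
         ++ [seq (x + y)%N :: w | w <- stuffle a' b']
     else [:: a]) b
  else [:: b].

Lemma stuffle0r a : stuffle a [::] = [:: a].
Proof. by case: a. Qed.

Lemma stuffle_cons x a y b :
  stuffle (x :: a) (y :: b) =
  [seq x :: w | w <- stuffle a (y :: b)] ++ [seq y :: w | w <- stuffle (x :: a) b]
    ++ [seq (x + y)%N :: w | w <- stuffle a b].
Proof. by []. Qed.

(* The letter s becomes p^s y, with [true] for p and [false] for y. *)
Definition to_bits (w : seq nat) : seq bool :=
  flatten [seq rcons (nseq s true) false | s <- w].

(** The argument [c] counts the p read since the last y. A trailing block of p is dropped; this
    loses nothing on duals, since a nonempty admissible word starts with p and its dual therefore
    ends with y. *)
Fixpoint of_bits (c : nat) (b : seq bool) : seq nat :=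
  match b with
  | [::] => [::]
  | true :: b' => of_bits c.+1 b'
  | false :: b' => c :: of_bits 0 b'
  end.

Definition dual_bits (b : seq bool) : seq bool := rev (map negb b).

Definition dual (w : seq nat) : seq nat := of_bits 0 (dual_bits (to_bits w)).

(** The convergence condition: a positive first letter makes q^(u_1), with u_1 the largest variable,
    divide every term, so each coefficient is a finite sum. *)
Definition admw (w : seq nat) : bool := if w is s :: _ then (0 < s)%N else true.

(** The final [false] keeps [of_bits] from losing letters; the pending count [c] returns as a prefix
    of [true]. *)
Lemma of_bitsK c b : to_bits (of_bits c (rcons b false)) = ncons c true (rcons b false).
Proof.
elim: b c => [|[] b IH] c /=; first by rewrite /to_bits /= cats0; elim: c => //= c ->.
  by rewrite IH; elim: c => //= c ->.
rewrite /to_bits /= in IH *; rewrite (IH 0%N) /=.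
by rewrite -cats1 -catA /=; elim: c => //= c ->.
Qed.

Lemma dualK w : admw w -> to_bits (dual w) = dual_bits (to_bits w).
Proof.
case: w => [|[|s] w] //= _; rewrite /dual /dual_bits /= rev_cons.
by rewrite /= of_bitsK.
Qed.

Lemma dual_bits_rcons w : w != [::] -> exists b, dual_bits (to_bits w) = true :: b.
Proof.
elim/last_ind: w => [//|w s _] _.
rewrite /dual_bits /to_bits map_rcons flatten_rcons map_cat rev_cat map_rcons rev_rcons /=.
by eexists.
Qed.

Lemma admw_of_bits c b : ((0 < c)%N || (if b is b0 :: _ then b0 else true)) -> admw (of_bits c b).
Proof. by elim: b c => [|[] b IH] [|c] //= _; apply: IH. Qed.

Lemma admw_dual w : admw (dual w).
Proof.
apply: admw_of_bits; case: (eqVneq w [::]) => [-> //|/dual_bits_rcons[b ->]].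
by rewrite orbT.
Qed.

Section IteratedSums.

Variable R : comNzRingType.
Implicit Types (f g : nat -> R) (fs : seq (nat -> R)).

Fixpoint itersum fs L m : R :=
  if fs is f :: fs' then \sum_(L <= u < m) f u * itersum fs' L u else 1.

(** The definition has the largest variable outermost. Exchanging the sums brings out the smallest
    one, which becomes the lower bound for the others; the proof of duality peels words from this
    end. *)
Lemma itersum_rcons fs f L m :
  itersum (rcons fs f) L m = \sum_(L <= u < m) f u * itersum fs u.+1 m.
Proof.
elim: fs m => [//|g fs IH] m /=.
transitivity (\sum_(L <= u < m) \sum_(L <= v < m | (v < u)%N)
                g u * (f v * itersum fs v.+1 u)).
  apply: eq_big_nat => u /andP[_ um]; rewrite IH mulr_sumr.
  by rewrite (big_nat_widen _ _ _ _ _ (ltnW um)).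
rewrite (exchange_big_dep_nat xpredT) //=.
apply: eq_big_nat => v /andP[Lv _].
rewrite mulr_sumr [RHS](big_nat_widenl _ L) ?(leqW Lv) //=.
by apply: eq_bigr => u _; rewrite mulrCA.
Qed.

(** Pairs of indices are sorted into v < u, u < v and u = v, the source of the three branches of
    [stuffle]. *)
Lemma mul_sum_nat f g L m :
  (\sum_(L <= u < m) f u) * (\sum_(L <= u < m) g u) =
  \sum_(L <= u < m) (f u * (\sum_(L <= v < u) g v) + g u * (\sum_(L <= v < u) f v)
                     + f u * g u).
Proof.
case: (leqP L m) => [Lm|mL]; last by rewrite !(big_geq (ltnW mL)) mulr0.
rewrite -(subnKC Lm); elim: (m - L)%N => [|k IH].
  by rewrite addn0 !big_geq // mulr0.
rewrite addnS [in RHS]big_nat_recr ?leq_addr //= -IH.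
by rewrite !(big_nat_recr (L + k)) ?leq_addr //=; ring.
Qed.

Variables (q : R) (M : nat).

(** The geometric series of q^u / (1 - q^u), cut at M; the cut is harmless once q^(n+1) = 0, n <= M
    and u > 0. *)
Definition zeta u : R := \sum_(1 <= v < M.+1) q ^+ (u * v).

Definition letters (w : seq nat) := [seq (fun u => zeta u ^+ s) | s <- w].

Definition wordsum (w : seq nat) L m : R := itersum (letters w) L m.

Lemma wordsum_cons s w L m :
  wordsum (s :: w) L m = \sum_(L <= u < m) zeta u ^+ s * wordsum w L u.
Proof. by []. Qed.

Lemma wordsum_stuffle a b L m :
  wordsum a L m * wordsum b L m = \sum_(w <- stuffle a b) wordsum w L m.
Proof.
elim: a b m => [|x a IHa] b m; first by rewrite /= big_seq1 mul1r.
elim: b m => [|y b IHb] m; first by rewrite stuffle0r big_seq1 mulr1.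
rewrite stuffle_cons !big_cat !big_map /= !wordsum_cons mul_sum_nat.
rewrite !big_split /= addrA; congr (_ + _ + _).
- by rewrite exchange_big /=; apply: eq_bigr => u _; rewrite -mulr_sumr -IHa mulrA.
- rewrite exchange_big /=; apply: eq_bigr => u _.
  by rewrite -mulr_sumr -IHb wordsum_cons mulrAC mulrA.
rewrite exchange_big /=; apply: eq_bigr => u _.
by rewrite -mulr_sumr -IHa exprD mulrACA.
Qed.

(** The sum over labelled words with two boundary totals, without which neither end could be peeled
    off by induction: [A] is the total label of the p preceding the word and [U] that of the y
    following it. The exponent is the sum of n_p m_y over pairs inside the word, plus [A] times the
    labels of its y, plus [U] times the labels of its p. *)
Fixpoint bitsum (b : seq bool) (A U : nat) : R :=
  match b with
  | [::] => 1
  | true :: b' => \sum_(1 <= n < M.+1) q ^+ (n * U) * bitsum b' (A + n) U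
  | false :: b' => \sum_(1 <= n < M.+1) q ^+ (A * n) * bitsum b' A U
  end.

Lemma bitsum_rcons_false b A U :
  bitsum (rcons b false) A U = \sum_(1 <= n < M.+1) q ^+ (A * n) * bitsum b A (U + n).
Proof.
elim: b A U => [//|[] b IH] A U /=.
  under eq_bigr do rewrite IH mulr_sumr.
  rewrite exchange_big_nat /=; apply: eq_bigr => m _; rewrite mulr_sumr.
  apply: eq_bigr => n _; rewrite !mulrA -!exprD; congr (q ^+ _ * _); lia.
under eq_bigr do rewrite IH mulr_sumr.
rewrite exchange_big_nat /=; apply: eq_bigr => m _; rewrite mulr_sumr.
by apply: eq_bigr => n _; rewrite mulrCA.
Qed.

Lemma bitsum_rcons_true b A U :
  bitsum (rcons b true) A U = \sum_(1 <= n < M.+1) q ^+ (n * U) * bitsum b A U.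
Proof.
elim: b A U => [//|[] b IH] A U /=; under eq_bigr do rewrite IH mulr_sumr;
  rewrite exchange_big_nat /=; apply: eq_bigr => m _; rewrite mulr_sumr;
  by apply: eq_bigr => n _; rewrite mulrCA.
Qed.

(** Reversing and exchanging maps a pair p before y to a pair of the same kind and swaps the two
    boundary totals. *)
Lemma bitsum_dual b A U : bitsum (dual_bits b) U A = bitsum b A U.
Proof.
elim: b A U => [//|[] b IH] A U; rewrite /dual_bits /= rev_cons.
  rewrite bitsum_rcons_false; apply: eq_bigr => n _.
  by rewrite [bitsum _ _ _]IH mulnC.
rewrite bitsum_rcons_true; apply: eq_bigr => n _.
by rewrite [bitsum _ _ _]IH mulnC.
Qed.

Lemma bitsum_nseq_true b s U :
  bitsum (b ++ nseq s true) 0 U = zeta U ^+ s * bitsum b 0 U.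
Proof.
elim: s => [|s IH]; first by rewrite cats0 mul1r.
rewrite -addn1 nseqD catA cats1 bitsum_rcons_true IH addn1 exprS -mulr_suml mulrA.
by congr (_ * _ * _); apply: eq_bigr => n _; rewrite mulnC.
Qed.

Variable n : nat.
Hypothesis qn : q ^+ n.+1 = 0.

Lemma expq0 k : (n < k)%N -> q ^+ k = 0.
Proof. by move=> nk; rewrite -(subnK nk) exprD qn mulr0. Qed.

Lemma zeta0 u : (n < u)%N -> zeta u = 0.
Proof.
move=> nu; rewrite /zeta big_nat big1 // => v /andP[v0 _].
by rewrite expq0 //; apply: leq_trans nu _; rewrite leq_pmulr.
Qed.

Hypothesis nM : (n <= M)%N.

(** Induction on the last letter: the label of the last y is the gap between [U] and the smallest
    summation variable u, and each p just before this y then sees the total u behind it and sums to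
    [zeta u]. *)
Lemma bitsum_wordsum w U : admw w -> (U <= M)%N ->
  bitsum (to_bits w) 0 U = wordsum w U.+1 M.+1.
Proof.
elim/last_ind: w U => [//|w s IH] U adm UM.
rewrite /to_bits map_rcons flatten_rcons -rcons_cat bitsum_rcons_false.
rewrite -/(to_bits w) /wordsum /letters map_rcons itersum_rcons.
under eq_bigr do rewrite mul0n expr0 mul1r bitsum_nseq_true.
(* Gaps up to M let u run up to [U + M]. The terms with u > n vanish because the first letter is
   positive, be it [s] itself or a letter of [w], so the range can be cut at M. *)
have van u : (n < u)%N -> zeta u ^+ s * bitsum (to_bits w) 0 u = 0.
  move=> nu; case: w adm {IH} => [|[//|x] w] adm.
    by rewrite zeta0 // expr0n; case: s adm => //= s _; rewrite mul0r.
  rewrite [bitsum _ _ _](_ : _ = 0) ?mulr0 //=.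
  rewrite big_nat big1 // => k /andP[k0 _].
  by rewrite expq0 ?mul0r //; apply: leq_trans nu _; rewrite leq_pmull.
have admw' : admw w by case: w adm {IH van}.
have -> : \sum_(1 <= i < M.+1) zeta (U + i) ^+ s * bitsum (to_bits w) 0 (U + i) =
          \sum_(U.+1 <= u < (U + M).+1) zeta u ^+ s * bitsum (to_bits w) 0 u.
  rewrite -[U.+1]add1n big_addn -addnS addKn.
  by apply: eq_bigr => i _; rewrite addnC.
rewrite (@big_cat_nat _ _ _ M.+1) //=; last by rewrite ltnS leq_addl.
rewrite [X in _ + X]big_nat [X in _ + X]big1 ?addr0 => [|u /andP[Mu _]]; last first.
  by rewrite van // (leq_ltn_trans nM).
by apply: eq_big_nat => u /andP[_ uM]; rewrite IH.
Qed.

Lemma wordsum_dual w : admw w -> wordsum (dual w) 1 M.+1 = wordsum w 1 M.+1.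
Proof.
move=> aw; rewrite -!bitsum_wordsum ?admw_dual //.
by rewrite dualK // bitsum_dual.
Qed.

End IteratedSums.

(** * Truncated q-series *)

Section Stability.

Variables (R : comNzRingType) (q : R).

Lemma eq_itersum (fs gs : seq (nat -> R)) L m :
  size fs = size gs ->
  (forall i u, (i < size fs)%N -> (L <= u < m)%N ->
     nth (fun=> 0) fs i u = nth (fun=> 0) gs i u) ->
  itersum fs L m = itersum gs L m.
Proof.
elim: fs gs m => [|f fs IH] [|g gs] m //= [sz] eqfg.
apply: eq_big_nat => u Lum; congr (_ * _); first exact: (eqfg 0%N).
apply: IH => // i v ifs /andP[Lv vu]; apply: (eqfg i.+1) => //.
by rewrite Lv (ltn_trans vu) //; case/andP: Lum.
Qed.

Variables (n M : nat).
Hypotheses (qn : q ^+ n.+1 = 0) (nM : (n <= M)%N).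

Lemma zeta_stable u : (0 < u)%N -> zeta q M u = zeta q n u.
Proof.
move=> u0; rewrite /zeta (@big_cat_nat _ _ _ n.+1) //=.
rewrite [X in _ + X]big_nat [X in _ + X]big1 ?addr0 // => v /andP[nv _].
by apply: (expq0 qn); apply: leq_trans nv _; rewrite leq_pmull.
Qed.

(** A variable or a geometric index beyond n contributes only multiples of q^(n+1); the positive
    first letter is what bounds the variables. *)
Lemma wordsum_stable w : admw w -> wordsum q M w 1 M.+1 = wordsum q n w 1 n.+1.
Proof.
have stab w' m : wordsum q M w' 1 m = wordsum q n w' 1 m.
  apply: eq_itersum; first by rewrite !size_map.
  move=> i u; rewrite size_map => iw /andP[u0 _].
  by rewrite !(nth_map 0%N) // zeta_stable.
rewrite stab; case: w => [//|[//|s] w] _; rewrite !wordsum_cons.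
rewrite (@big_cat_nat _ _ _ n.+1) //= [X in _ + X]big_nat [X in _ + X]big1 ?addr0 //.
by move=> u /andP[nu _]; rewrite (zeta0 _ qn) // exprS !mul0r.
Qed.

End Stability.

Section Morphism.

Variables (R S : comNzRingType) (f : {rmorphism R -> S}) (q : R) (M : nat).

Lemma rmorph_zeta u : f (zeta q M u) = zeta (f q) M u.
Proof. by rewrite /zeta rmorph_sum; apply: eq_bigr => v _; rewrite rmorphXn. Qed.

Lemma rmorph_wordsum w L m : f (wordsum q M w L m) = wordsum (f q) M w L m.
Proof.
elim: w m => [|s w IH] m; first exact: rmorph1.
rewrite !wordsum_cons rmorph_sum; apply: eq_bigr => u _.
by rewrite rmorphM rmorphXn /= rmorph_zeta IH.
Qed.

End Morphism.

Section BinomialSeries.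

Variables (R : comNzRingType) (x : R) (n : nat).
Hypothesis xn : x ^+ n.+1 = 0.

(** This expands (x / (1-x))^(j+1). As x is nilpotent, z (1-x) = x and (1+z) (1-x) = 1 hold exactly,
    and multiplication by 1-x lowers j by Pascal's rule. *)
Lemma binomial_series j :
  \sum_(1 <= v < n.+1) x ^+ v *+ 'C(v.-1, j) = (\sum_(1 <= v < n.+1) x ^+ v) ^+ j.+1.
Proof.
set z := \sum_(1 <= v < n.+1) x ^+ v.
have shift (F : nat -> R) : F n.+1 = 0 ->
    \sum_(1 <= v < n.+1) F v = F 1%N + \sum_(1 <= v < n.+1) F v.+1.
  move=> Fn; transitivity (\sum_(1 <= v < n.+2) F v).
    by rewrite (big_nat_recr n.+1) //= Fn addr0.
  by rewrite big_ltn // big_add1.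
have zx : z * (1 - x) = x.
  rewrite mulrBr mulr1 {1}/z shift // mulr_suml expr1 -addrA -sumrB big1 ?addr0 // => v _.
  by rewrite exprSr subrr.
elim: j => [|j IH]; first by rewrite expr1; apply: eq_bigr => v _; rewrite bin0.
set Y := \sum_(1 <= v < _) _.
have xY : (1 - x) * Y = x * z ^+ j.+1.
  rewrite -IH mulrBl mul1r {1}/Y shift; last by rewrite xn mul0rn.
  rewrite bin0n mulr0n add0r.
  rewrite /Y !mulr_sumr -sumrB big_nat [RHS]big_nat; apply: eq_bigr => v /andP[v0 _] /=.
  by rewrite !mulrnAr -!exprS -[v in 'C(v, _)](prednK v0) binS mulrnDr addrC addKr.
have -> : Y = (1 + z) * ((1 - x) * Y).
  by rewrite mulrA mulrDl zx; ring.
rewrite xY mulrA [z ^+ j.+2]exprS; congr (_ * _).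
by rewrite mulrDl mul1r -{1}zx; ring.
Qed.

End BinomialSeries.

(** * Truncated power series rings and the coefficients of words *)

Notation trunc n := {poly %/ ('X^(n.+1) : {poly rat})}.
Definition qt n : trunc n := in_qpoly 'X^(n.+1) 'X.

Definition lastcoef n (x : trunc n) : rat := (x : {poly rat})`_n.

Lemma lastcoef_sum n I (r : seq I) (P : pred I) (F : I -> trunc n) :
  lastcoef (\sum_(i <- r | P i) F i) = \sum_(i <- r | P i) lastcoef (F i).
Proof. by rewrite /lastcoef poly_of_qpoly_sum coef_sum. Qed.

Lemma lastcoefZ n a (x : trunc n) : lastcoef (a *: x) = a * lastcoef x.
Proof. by rewrite /lastcoef poly_of_qpolyZ coefZ. Qed.

Lemma size_trunc n : size (mk_monic ('X^(n.+1) : {poly rat})) = n.+2.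
Proof. by rewrite mk_monic_Xn size_polyXn. Qed.

Lemma in_qpoly_Xn n k : in_qpoly 'X^(n.+1) 'X^k = qt n ^+ k.
Proof. by rewrite rmorphXn. Qed.

Lemma qt_nilp n : qt n ^+ n.+1 = 0.
Proof.
rewrite -in_qpoly_Xn; apply/val_eqP => /=.
by rewrite mk_monic_Xn /= Pdiv.RingMonic.rmodpp ?monicXn.
Qed.

Lemma lastcoef_qt n k : lastcoef (qt n ^+ k) = (k == n)%:R.
Proof.
case: (leqP k n) => [kn|nk]; last first.
  by rewrite (expq0 (qt_nilp n)) // /lastcoef coef0 gtn_eqF.
rewrite -in_qpoly_Xn /lastcoef in_qpoly_small ?coefXn 1?eq_sym //.
by rewrite size_trunc size_polyXn.
Qed.

Lemma lastcoef_in_qpoly n p : lastcoef (in_qpoly 'X^(n.+1) p : trunc n) = p`_n.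
Proof.
rewrite -[in LHS](coefK p) poly_def linear_sum lastcoef_sum /=.
under eq_bigr do rewrite linearZ /= in_qpoly_Xn lastcoefZ lastcoef_qt.
case: (ltnP n (size p)) => [np|pn]; last first.
  rewrite big1 ?nth_default // => i _.
  by rewrite [_ == _]ltn_eqF ?mulr0 //; apply: leq_trans pn.
rewrite (bigD1 (Ordinal np)) //= eqxx mulr1 big1 ?addr0 // => i ne.
by rewrite [_ == n](negbTE ne) mulr0.
Qed.

(** Each coefficient is read in its own quotient ring, where all sums are finite. *)
Definition wordfps (w : seq nat) : fps :=
  fun n => lastcoef (wordsum (qt n) n w 1 n.+1).

Lemma wordfps_dual w : admw w -> wordfps (dual w) =1 wordfps w.
Proof. by move=> aw n; rewrite /wordfps (wordsum_dual (qt_nilp n)). Qed.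

Lemma wordfps_stuffle a b a' b' n : admw a -> admw b ->
    a' \in [:: a; dual a] -> b' \in [:: b; dual b] ->
  \sum_(w <- stuffle a b) wordfps w n = \sum_(w <- stuffle a' b') wordfps w n.
Proof.
move=> aa ab ha hb; rewrite /wordfps -!lastcoef_sum -!wordsum_stuffle.
have eqd c c' : admw c -> c' \in [:: c; dual c] ->
    wordsum (qt n) n c' 1 n.+1 = wordsum (qt n) n c 1 n.+1.
  by move=> ac; rewrite !inE => /orP[] /eqP -> //; rewrite ?(wordsum_dual (qt_nilp n)).
by rewrite (eqd _ _ aa ha) (eqd _ _ ab hb).
Qed.

(** For computation a single polynomial ring over the integers replaces the quotient rings: up to
    degree [N] nothing changes, and integrality permits reduction modulo 3. *)
Lemma wordfps_poly N w n : admw w -> (n <= N)%N ->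
  wordfps w n = ((wordsum 'X N w 1 N.+1 : {poly int})`_n)%:~R.
Proof.
move=> aw nN; rewrite /wordfps -(wordsum_stable (qt_nilp n) nN) //.
have -> : qt n = in_qpoly 'X^(n.+1) (map_poly intr ('X : {poly int})).
  by rewrite map_polyX.
by rewrite -!rmorph_wordsum /= lastcoef_in_qpoly coef_map.
Qed.

(** * From bi-brackets to words and from words to brackets *)

(** A letter 0 counts 1 because it stands for one factor u, that is, one unit of some r_j. *)
Definition wordweight (w : seq nat) : nat := sumn [seq maxn s 1 | s <- w].

Lemma wordweight_stuffle a b w :
  w \in stuffle a b -> (wordweight w <= wordweight a + wordweight b)%N.
Proof.
elim: a b w => [|x a IHa] b w; first by rewrite inE => /eqP ->.
elim: b w => [|y b IHb] w; first by rewrite stuffle0r inE addn0 => /eqP ->.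
rewrite stuffle_cons !mem_cat => /or3P[] /mapP[v hv ->].
- by move: (IHa _ _ hv); rewrite /wordweight /=; lia.
- by move: (IHb _ hv); rewrite /wordweight /=; lia.
by move: (IHa _ _ hv); rewrite /wordweight /=; lia.
Qed.

(* A [truncfam] is given simultaneously in all the rings [trunc n], so that the
   coefficients of a combination do not depend on n. *)
Definition truncfam := forall n : nat, nat -> trunc n.

Section Spanned.

Variables (G : seq nat -> truncfam) (P : pred (seq nat)).

(** The bound [m] is kept free so that a combination can be nested under a further summation
    variable. The value m = 0 is excluded because the identity m = 1 + (m - 1), used to create
    letters 0, fails there for natural numbers. *)
Definition spanned (F : truncfam) : Prop :=
  exists2 c : seq (rat * seq nat), all (fun x => P x.2) c &
    forall n m, (0 < m)%N -> F n m = \sum_(x <- c) x.1 *: G x.2 n m.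

Lemma spanned_ext F F' :
  (forall n m, (0 < m)%N -> F n m = F' n m) -> spanned F -> spanned F'.
Proof. by move=> eF [c Pc cE]; exists c => // n m m0; rewrite -eF ?cE. Qed.

Lemma spanned0 : spanned (fun _ _ => 0).
Proof. by exists [::] => // n m _; rewrite big_nil. Qed.

Lemma spanned_mem w : P w -> spanned (G w).
Proof. by move=> Pw; exists [:: (1, w)] => /= [|n m _]; rewrite ?Pw // big_seq1 scale1r. Qed.

Lemma spannedD F F' : spanned F -> spanned F' -> spanned (fun n m => F n m + F' n m).
Proof.
move=> [c Pc cE] [c' Pc' cE']; exists (c ++ c'); first by rewrite all_cat Pc.
by move=> n m m0; rewrite big_cat -cE ?cE'.
Qed.

Lemma spannedZ a F : spanned F -> spanned (fun n m => a *: F n m).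
Proof.
move=> [c Pc cE]; exists [seq (a * x.1, x.2) | x <- c]; first by rewrite all_map.
move=> n m m0; rewrite big_map cE // scaler_sumr.
by apply: eq_bigr => x _; rewrite scalerA.
Qed.

Lemma spanned_sum I (r : seq I) (Q : pred I) (F : I -> truncfam) :
  (forall i, Q i -> spanned (F i)) -> spanned (fun n m => \sum_(i <- r | Q i) F i n m).
Proof.
move=> sF; elim: r => [|i r IH].
  by apply: spanned_ext spanned0 => n m _; rewrite big_nil.
case: (boolP (Q i)) => Qi.
  by apply: spanned_ext (spannedD (sF i Qi) IH) => n m _; rewrite big_cons Qi.
by apply: spanned_ext IH => n m _; rewrite big_cons (negbTE Qi).
Qed.

End Spanned.

Lemma spanned_trans G G' (P P' : pred (seq nat)) F :
  (forall w, P w -> spanned G' P' (G w)) -> spanned G P F -> spanned G' P' F.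
Proof.
move=> sG [c Pc cE]; elim: c F Pc cE => [|x c IH] F /= Pc cE.
  by apply: spanned_ext (spanned0 G' P') => n m m0; rewrite cE // big_nil.
case/andP: Pc => Px Pc.
apply: (spanned_ext (F := fun n m => x.1 *: G x.2 n m + \sum_(y <- c) y.1 *: G y.2 n m)).
  by move=> n m m0; rewrite cE // big_cons.
apply: spannedD; first exact/spannedZ/sG.
by apply: IH.
Qed.

Lemma spanned_sum_nat G (P : pred (seq nat)) G' (P' : pred (seq nat))
    (f : truncfam) F :
  (forall w, P w -> spanned G' P' (fun n m => \sum_(1 <= u < m) f n u * G w n u)) ->
  spanned G P F -> spanned G' P' (fun n m => \sum_(1 <= u < m) f n u * F n u).
Proof.
move=> sG [c Pc cE].
apply: (spanned_ext (F := fun n m =>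
   \sum_(x <- c) x.1 *: \sum_(1 <= u < m) f n u * G x.2 n u)).
  move=> n m _; under eq_bigr do rewrite scaler_sumr.
  rewrite exchange_big /=; apply: eq_big_nat => u /andP[u0 _].
  by rewrite cE // mulr_sumr; apply: eq_bigr => x _; rewrite scalerAr.
elim: c Pc {cE} => [|x c IH] /= Pc.
  by apply: spanned_ext (spanned0 G' P') => n m m0; rewrite big_nil.
case/andP: Pc => Px Pc.
apply: spanned_ext (spannedD (spannedZ x.1 (sG _ Px)) (IH Pc)) => n m _.
by rewrite big_cons.
Qed.

Definition wordfam (w : seq nat) : truncfam := fun n m => wordsum (qt n) n w 1 m.

Definition spanned_words := spanned wordfam.

(** The word [0] sums to m - 1, so m F = F + [0] F, and the product with [0] is a quasi-shuffle. In
    the application m is the outer variable u and F the inner sum. *)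
Lemma spanned_words_mulu k F : spanned_words (fun w => wordweight w <= k)%N F ->
  spanned_words (fun w => wordweight w <= k.+1)%N (fun n m => m%:R * F n m).
Proof.
move=> sF; case: (sF) => c _ cE.
have E n m : (0 < m)%N -> m%:R * F n m = F n m + wordfam [:: 0%N] n m * F n m.
  move=> m0; rewrite -{1}(prednK m0) mulrS mulrDl mul1r; congr (_ + _ * _).
  rewrite /wordfam wordsum_cons; under eq_bigr do rewrite mul1r.
  by rewrite sumr_const_nat subn1.
apply: spanned_ext; first by move=> n m m0; rewrite E.
apply: spannedD; first by apply: spanned_trans sF => w wk; apply: spanned_mem; apply: leqW.
case: sF => {c cE E}c Pc cE.
apply: (spanned_ext (F := fun n m => \sum_(x <- c) x.1 *:
          \sum_(w <- stuffle [:: 0%N] x.2) wordfam w n m)).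
  move=> n m m0; rewrite cE // mulr_sumr; apply: eq_bigr => x _.
  by rewrite -scalerAr /wordfam wordsum_stuffle.
(* Membership in the lists is turned into weight filters, the form in which [spanned_sum]
   applies. *)
apply: (spanned_ext (F := fun n m => \sum_(x <- c | (wordweight x.2 <= k)%N) x.1 *:
          \sum_(w <- stuffle [:: 0%N] x.2 | (wordweight w <= k.+1)%N) wordfam w n m)).
  move=> n m _; rewrite big_seq_cond [RHS]big_seq; apply: eq_big => x.
    by rewrite andb_idr // => /(allP Pc).
  move=> /andP[_ xk]; congr (_ *: _); rewrite big_seq_cond [RHS]big_seq.
  apply: eq_bigl => w; rewrite andb_idr // => /wordweight_stuffle.
  by rewrite {1}/wordweight /= => h; apply: leq_trans h _.
apply: spanned_sum => x xk; apply: spannedZ; apply: spanned_sum => w wk.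
exact: spanned_mem.
Qed.

(** The identity v C(v-1, j) = (j+1) C(v, j+1) = (j+1) (C(v-1, j) + C(v-1, j+1)) removes one power
    of v at a time, down to [binomial_series]. *)
Lemma power_binomial_zeta a j : exists c : nat -> rat, forall n u, (0 < u)%N ->
  \sum_(1 <= v < n.+1) (v%:R ^+ a * 'C(v.-1, j)%:R : rat) *: qt n ^+ (u * v) =
  \sum_(i < a.+1) c i *: zeta (qt n) n u ^+ (i + j).+1.
Proof.
elim: a j => [|a IH] j.
  exists (fun=> 1) => n u u0; rewrite big_ord1 scale1r add0n /zeta.
  under [X in _ = X ^+ _]eq_bigr do rewrite exprM.
  rewrite -binomial_series; last by rewrite -exprM mulnC exprM qt_nilp expr0n eqn0Ngt u0.
  by apply: eq_bigr => v _; rewrite expr0 mul1r scaler_nat exprM.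
have binE v : (0 < v)%N -> v%:R ^+ a.+1 * 'C(v.-1, j)%:R =
    j.+1%:R * (v%:R ^+ a * 'C(v.-1, j)%:R + v%:R ^+ a * 'C(v.-1, j.+1)%:R) :> rat.
  move=> v0; rewrite exprSr -mulrA -mulrDr [RHS]mulrCA; congr (_ * _).
  rewrite -natrD addnC -binS prednK // -!natrM; congr _%:R.
  exact: mul_bin_diag.
have [c cE] := IH j; have [d dE] := IH j.+1.
exists (fun i => j.+1%:R * ((if (i < a.+1)%N then c i else 0) + (if i is i'.+1 then d i' else 0))).
move=> n u u0.
transitivity (j.+1%:R *: (\sum_(i < a.+1) c i *: zeta (qt n) n u ^+ (i + j).+1
     + \sum_(i < a.+1) d i *: zeta (qt n) n u ^+ (i + j.+1).+1)).
  transitivity (j.+1%:R *: (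
      \sum_(1 <= v < n.+1) (v%:R ^+ a * 'C(v.-1, j)%:R : rat) *: qt n ^+ (u * v) +
      \sum_(1 <= v < n.+1) (v%:R ^+ a * 'C(v.-1, j.+1)%:R : rat) *: qt n ^+ (u * v))); last first.
    by congr (_ *: (_ + _)); [exact: cE | exact: dE].
  rewrite -big_split [RHS]scaler_sumr.
  apply: eq_big_nat => v /andP[v0 _] /=.
  by rewrite -scalerDl scalerA binE.
under [RHS]eq_bigr do rewrite -scalerA scalerDl.
rewrite -scaler_sumr big_split /=; congr (_ *: (_ + _)).
  rewrite [RHS]big_ord_recr /= ltnn scale0r addr0.
  by apply: eq_bigr => i _; rewrite ltn_ord.
by rewrite [RHS]big_ord_recl scale0r add0r; apply: eq_bigr => i _; rewrite addSnnS.
Qed.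

Definition biletter (sr : nat * nat) n u : trunc n :=
  \sum_(1 <= v < n.+1) (u%:R ^+ sr.2 / sr.2`!%:R * (v%:R ^+ sr.1.-1 / sr.1.-1`!%:R))
     *: qt n ^+ (u * v).

Definition bifam (w : seq (nat * nat)) : truncfam :=
  fun n m => itersum [seq biletter x n | x <- w] 1 m.

Lemma spanned_letter k F j :
  spanned_words (fun w => wordweight w <= k)%N F ->
  spanned_words (fun w => admw w && (wordweight w <= k + j.+1))%N
    (fun n m => \sum_(1 <= u < m) zeta (qt n) n u ^+ j.+1 * F n u).
Proof.
apply: spanned_sum_nat => w wk.
apply: (@spanned_mem wordfam _ (j.+1 :: w)).
by rewrite /= /wordweight /= addnC leq_add //; lia.
Qed.

(** The power of u is moved onto the inner sum, where it becomes letters 0; the polynomial in v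
    becomes powers z^i with 1 <= i <= s in front, and this positive front letter gives
    admissibility. *)
Lemma spanned_biletter k F s r : (0 < s)%N ->
  spanned_words (fun w => wordweight w <= k)%N F ->
  spanned_words (fun w => admw w && (wordweight w <= k + s + r))%N
    (fun n m => \sum_(1 <= u < m) biletter (s, r) n u * F n u).
Proof.
move=> s0 sF.
have {}sF : spanned_words (fun w => wordweight w <= k + r)%N (fun n m => m%:R ^+ r * F n m).
  elim: r => [|r IH].
    by rewrite addn0; apply: spanned_ext sF => n m _; rewrite mul1r.
  rewrite addnS; apply: spanned_ext (spanned_words_mulu IH) => n m _.
  by rewrite mulrA -exprS.
have [c cE] := power_binomial_zeta s.-1 0.
have bE n u : (0 < u)%N -> biletter (s, r) n u = \sum_(i < s)
    ((r`!%:R * s.-1`!%:R)^-1 * c i * u%:R ^+ r) *: zeta (qt n) n u ^+ i.+1.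
  move=> u0; transitivity (((r`!%:R * s.-1`!%:R)^-1 * u%:R ^+ r) *:
      \sum_(i < s.-1.+1) c i *: zeta (qt n) n u ^+ (i + 0).+1).
    rewrite -(cE n u u0) [RHS]scaler_sumr; apply: eq_bigr => v _.
    rewrite [RHS]scalerA; congr (_ *: _); rewrite bin0 mulr1 invfM /=; ring.
  rewrite (prednK s0) [LHS]scaler_sumr; apply: eq_bigr => i _.
  by rewrite scalerA addn0 mulrAC.
apply: (spanned_ext (F := fun n m => (r`!%:R * s.-1`!%:R)^-1 *: \sum_(i < s) c i *:
   \sum_(1 <= u < m) zeta (qt n) n u ^+ i.+1 * (u%:R ^+ r * F n u))).
  move=> n m _.
  under eq_bigr do rewrite scaler_sumr.
  rewrite exchange_big [LHS]scaler_sumr; apply: eq_big_nat => u /andP[u0 _].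
  rewrite (bE n u u0) mulr_suml [LHS]scaler_sumr; apply: eq_bigr => i _.
  rewrite -[_ *: _ * _]scalerAl scalerA mulrCA (_ : u%:R ^+ r = (u%:R ^+ r)%:A :> trunc n).
    by rewrite -[_ *: 1 * _]scalerAl mul1r scalerA.
  by rewrite -!natrX scaler_nat.
apply: spannedZ; apply: spanned_sum => i _; apply: spannedZ.
apply: spanned_trans (spanned_letter i sF) => w /andP[aw wk].
by apply: spanned_mem; rewrite aw (leq_trans wk) // addnAC leq_add2r leq_add2l.
Qed.

Lemma bifam_spanned (w : seq (nat * nat)) : all (fun x => 0 < x.1)%N w ->
  spanned_words (fun v => admw v && (wordweight v <= sumn [seq x.1 + x.2 | x <- w]))%N (bifam w).
Proof.
elim: w => [_|[s r] w IH /=]; first exact: (@spanned_mem _ _ [::]).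
case/andP=> s0 /IH sw; rewrite addnC addnA; apply: spanned_biletter => //.
apply: spanned_trans sw => v /andP[_ vk]; exact: spanned_mem.
Qed.

Definition bracketfam (w : seq nat) : truncfam := bifam [seq (s, 0%N) | s <- w].

(** The coefficients C(v-1, s-1) of z^s form a polynomial of degree s-1 in v, hence a combination of
    v^(t-1) / (t-1)! with t <= s. *)
Lemma zeta_biletter s : s \in [:: 1; 2; 3]%N ->
  exists2 c : seq (rat * nat), all (fun x => (x.2 \in [:: 1; 2; 3]) && (x.2 <= s))%N c &
   forall n u, (0 < u)%N -> zeta (qt n) n u ^+ s = \sum_(x <- c) x.1 *: biletter (x.2, 0%N) n u.
Proof.
move=> s123.
have zE n u : (0 < u)%N -> zeta (qt n) n u ^+ s =
    \sum_(1 <= v < n.+1) ('C(v.-1, s.-1)%:R : rat) *: qt n ^+ (u * v).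
  move=> u0; rewrite /zeta; under eq_bigr do rewrite exprM.
  have -> : s = s.-1.+1 by move: s123; rewrite !inE; case: s.
  rewrite -binomial_series; last by rewrite -exprM mulnC exprM qt_nilp expr0n eqn0Ngt u0.
  by apply: eq_bigr => v _; rewrite scaler_nat exprM.
have bE (c : seq (rat * nat)) n u : \sum_(x <- c) x.1 *: biletter (x.2, 0%N) n u =
    \sum_(1 <= v < n.+1) (\sum_(x <- c) x.1 * (v%:R ^+ x.2.-1 / x.2.-1`!%:R)) *: qt n ^+ (u * v).
  under eq_bigr do rewrite scaler_sumr.
  rewrite exchange_big /=; apply: eq_bigr => v _; rewrite scaler_suml.
  by apply: eq_bigr => x _; rewrite scalerA expr0 divr1 mul1r.
suff [c Pc cE] : exists2 c : seq (rat * nat),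
    all (fun x => (x.2 \in [:: 1; 2; 3]) && (x.2 <= s))%N c &
    forall v, 'C(v, s.-1)%:R = \sum_(x <- c) x.1 * (v.+1%:R ^+ x.2.-1 / x.2.-1`!%:R) :> rat.
  exists c => // n u u0; rewrite zE // bE; apply: eq_big_nat => v /andP[v0 _].
  by rewrite cE prednK.
move: s123; rewrite !inE => /or3P[] /eqP ->.
- by exists [:: (1, 1%N)] => // v; rewrite big_seq1 bin0 fact0 expr0.
- exists [:: (1, 2%N); (-1, 1%N)] => // v.
  rewrite big_cons big_seq1 bin1 /= -natr1 !(factS, fact0) expr0 expr1 muln1 !divr1; ring.
(* C(v, 2) = (v+1)^2 / 2 - (3/2) (v+1) + 1; the argument is shifted because v+1 is the summation
   index here. *)
pose c : seq (rat * nat) := [:: (1, 3%N); (- (3%:R / 2%:R), 2%N); (1, 1%N)].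
exists c => [|v]; first by [].
rewrite /c.
rewrite !big_cons big_nil /= -natr1 !(factS, fact0) expr1 expr0 addr0 !muln1.
have -> : 'C(v, 2)%:R = v%:R * (v%:R - 1) / 2%:R :> rat.
  have := congr1 (fun t => t%:R : rat) (bin_ffact v 2).
  rewrite natrM ffactnSr ffactn1; case: v => [|v]; first by rewrite !mul0r.
  by rewrite natrM subn1 /= -natr1 addrK => <-; rewrite mulfK.
by field.
Qed.

(** In the absence of letters 0 every letter is rewritten on its own, with lower entry 0 and without
    raising the weight. *)
Lemma word123_spanned w : all (fun s => s \in [:: 1; 2; 3]%N) w ->
  spanned bracketfam (fun v => all (fun s => s \in [:: 1; 2; 3]%N) v && (sumn v <= wordweight w))%N
    (wordfam w).
Proof.
elim: w => [_|s w IH /=]; first exact: (@spanned_mem _ _ [::]).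
case/andP=> s123 /IH sw; have [c Pc cE] := zeta_biletter s123.
apply: (spanned_ext (F := fun n m => \sum_(x <- c | (x.2 \in [:: 1; 2; 3]%N) && (x.2 <= s)%N)
   x.1 *: \sum_(1 <= u < m) biletter (x.2, 0%N) n u * wordfam w n u)).
  move=> n m _; rewrite /wordfam wordsum_cons.
  rewrite big_seq_cond (eq_bigl (fun x => x \in c)) -?big_seq; last first.
    by move=> x; rewrite andb_idr // => /(allP Pc).
  under eq_bigr do rewrite scaler_sumr.
  rewrite exchange_big /=; apply: eq_big_nat => u /andP[u0 _].
  by rewrite cE // mulr_suml; apply: eq_bigr => x _; rewrite scalerAl.
apply: spanned_sum => x /andP[x123 xs]; apply: spannedZ.
apply: spanned_sum_nat sw => v /andP[v123 vk].
apply: (@spanned_mem bracketfam _ (x.2 :: v)) => /=.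
rewrite x123 v123 /= /wordweight /=; apply: leq_add => //.
by rewrite (leq_trans xs) // leq_maxl.
Qed.

(** * Bi-brackets as iterated sums *)

Section FfunCons.

Variables (T : finType) (l : nat).

Definition ffun_cons (p : T * {ffun 'I_l -> T}) : {ffun 'I_l.+1 -> T} :=
  [ffun j => if unlift ord0 j is Some i then p.2 i else p.1].

Lemma ffun_cons0 p : ffun_cons p ord0 = p.1.
Proof. by rewrite ffunE unlift_none. Qed.

Lemma ffun_consS p i : ffun_cons p (lift ord0 i) = p.2 i.
Proof. by rewrite ffunE liftK. Qed.

Lemma ffun_cons_bij : bijective ffun_cons.
Proof.
pose g (u : {ffun 'I_l.+1 -> T}) : T * {ffun 'I_l -> T} :=
  (u ord0, [ffun i => u (lift ord0 i)]).
exists g => [[x u]|u].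
  rewrite /g ffun_cons0; congr pair.
  by apply/ffunP => i; rewrite ffunE ffun_consS.
apply/ffunP => j; case: (unliftP ord0 j) => [i|] ->.
  by rewrite ffun_consS ffunE.
by rewrite ffun_cons0.
Qed.

End FfunCons.

(** Splitting off the first, largest variable makes it the upper bound for the rest, whence the
    extra condition with a general [m]. *)
Lemma itersum_ffun (R : comNzRingType) n l (f : 'I_l -> nat -> R) m : (m <= n.+1)%N ->
  itersum [seq f j | j <- enum 'I_l] 1 m =
  \sum_(u : {ffun 'I_l -> 'I_n.+1} |
      ([forall j, (0 < u j)%N] &&
       [forall i : 'I_l, forall j : 'I_l, (i < j)%N ==> (u j < u i)%N])
      && [forall j, (u j < m)%N])
    \prod_j f j (u j).
Proof.
elim: l f m => [|l IH] f m mn.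
  rewrite (big_pred1 [ffun=> ord0]) => [|u].
    by rewrite big_ord0; have /eqP/size0nil -> : size (enum 'I_0) == 0%N by rewrite size_enum_ord.
  rewrite /= [RHS](_ : _ = true); last by apply/eqP/ffunP => -[].
  by apply/andP; split; [apply/andP; split|]; apply/forallP => -[].
rewrite enum_ordSl /= -map_comp.
rewrite (reindex _ (onW_bij _ (ffun_cons_bij _ _))) /=.
transitivity (\sum_(x : 'I_n.+1 | (0 < x < m)%N)
    \sum_(u : {ffun 'I_l -> 'I_n.+1} |
      ([forall j, (0 < u j)%N] &&
       [forall i : 'I_l, forall j : 'I_l, (i < j)%N ==> (u j < u i)%N])
      && [forall j, (u j < x)%N])
    f ord0 x * \prod_j f (lift ord0 j) (u j)); last first.
  rewrite pair_big_dep /=; apply: eq_big => [[x u]|[x u] _]; last first.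
    rewrite big_ord_recl ffun_cons0; congr (_ * _).
    by apply: eq_bigr => j _; rewrite ffun_consS.
  apply/idP/idP.
    move=> /andP[/andP[x0 xm] /andP[/andP[/forallP u0 /forallP ud] /forallP ux]].
    apply/andP; split; first (apply/andP; split); apply/forallP => j;
      case: (unliftP ord0 j) => [i|] ->; rewrite ?ffun_consS ?ffun_cons0 //=.
    - apply/forallP => k; case: (unliftP ord0 k) => [k'|] ->; rewrite ?ffun_consS ?ffun_cons0 //=.
      by rewrite /bump !leq0n ltnS; apply: (forallP (ud i)).
    - apply/forallP => k; case: (unliftP ord0 k) => [k'|] ->; rewrite ?ffun_consS ?ffun_cons0 //=.
    exact: ltn_trans (ux i) xm.
  move=> /andP[/andP[/forallP u0 /forallP ud] /forallP um].
  have := u0 ord0; have := um ord0; rewrite !ffun_cons0 /= => -> -> /=.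
  apply/andP; split; first (apply/andP; split); apply/forallP => j.
  - by have := u0 (lift ord0 j); rewrite ffun_consS.
  - apply/forallP => k; have := forallP (ud (lift ord0 j)) (lift ord0 k).
    by rewrite !ffun_consS /= /bump !leq0n ltnS.
  by have := forallP (ud ord0) (lift ord0 j); rewrite ffun_consS ffun_cons0.
rewrite (big_nat_widen _ _ _ _ _ mn) (big_nat_widenl _ 0) // big_mkord.
apply: eq_big => [x|x /andP[_ xm]]; first by rewrite andbC.
by rewrite IH ?mulr_sumr // ltnW // (leq_trans xm).
Qed.

Lemma seq_ofE (T : Type) (l : nat) (s : l.-tuple T) : tval s = [seq tnth s j | j <- enum 'I_l].
Proof. by rewrite -[in LHS](map_tnth_enum s). Qed.

(** Expanding the product of the inner sums gives one monomial, of exponent sum u_j v_j, for each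
    choice of v; the coefficient of q^n keeps the v of the definition. *)
Lemma bibracketE l (s r : l.-tuple nat) n :
  bibracket s r n = lastcoef (bifam (zip s r) n n.+1).
Proof.
rewrite /bifam (_ : zip s r = [seq (tnth s j, tnth r j) | j <- enum 'I_l]); last first.
  by rewrite (seq_ofE s) (seq_ofE r); elim: (enum 'I_l) => //= j e ->.
rewrite -map_comp (itersum_ffun (n := n)) // lastcoef_sum /bibracket.
rewrite [RHS](eq_bigl (fun u : {ffun 'I_l -> 'I_n.+1} => [forall j, (0 < u j)%N] &&
   [forall i : 'I_l, forall j : 'I_l, (i < j)%N ==> (u j < u i)%N])); last first.
  by move=> u /=; rewrite andb_idr // => _; apply/forallP => j.
apply: eq_bigr => u _.
pose c (j : 'I_l) (v : nat) : rat := (u j)%:R ^+ tnth r j / (tnth r j)`!%:R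
           * (v%:R ^+ (tnth s j).-1 / ((tnth s j).-1)`!%:R).
transitivity (lastcoef (\prod_(j < l) \sum_(v < n.+1 | (0 < v)%N) c j v *: qt n ^+ (u j * v))).
  rewrite bigA_distr_big lastcoef_sum [RHS]big_mkcond [LHS]big_mkcond /=.
  apply: eq_bigr => v _.
  rewrite (_ : (v \in ffun_on _) = [forall j, (0 < v j)%N]); last first.
    by apply/ffun_onP/forallP.
  case: [forall j, _] => //=.
  have -> : \prod_i (c i (v i) *: qt n ^+ (u i * v i)) =
      (\prod_i c i (v i)) *: qt n ^+ (\sum_i u i * v i)%N.
    by rewrite scaler_prod prodrXr.
  rewrite lastcoefZ lastcoef_qt; case: eqP => _; rewrite ?mulr1 ?mulr0 //.
congr lastcoef; apply: eq_bigr => j _.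
rewrite /biletter /= [RHS](big_nat_widenl _ 0) // big_mkord.
by apply: eq_bigl => v.
Qed.

(** * Certificates modulo 3 *)

(** Digits modulo 3 as bare constructors, which evaluate cheaply; [T2] stands for -1. *)
Inductive trit := T0 | T1 | T2.

Definition trit_code (t : trit) : option bool :=
  match t with T0 => None | T1 => Some true | T2 => Some false end.

Lemma trit_codeK : cancel trit_code
  (fun o => if o is Some b then if b then T1 else T2 else T0).
Proof. by case. Qed.

HB.instance Definition _ := Equality.copy trit (can_type trit_codeK).

Definition tadd (x y : trit) : trit :=
  match x, y with
  | T0, z | z, T0 => z
  | T1, T1 => T2
  | T2, T2 => T1
  | _, _ => T0
  end.

Definition topp (x : trit) : trit := match x with T0 => T0 | T1 => T2 | T2 => T1 end.

(** A missing tail counts as zeros, so vectors are lists up to trailing zeros. *)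
Fixpoint vadd (x y : seq trit) : seq trit :=
  match x, y with
  | [::], z | z, [::] => z
  | a :: x', b :: y' => tadd a b :: vadd x' y'
  end.

Definition vopp (x : seq trit) := map topp x.

Definition vzero (x : seq trit) : bool := all (fun t => if t is T0 then true else false) x.

Definition veq (x y : seq trit) : bool := vzero (vadd x (vopp y)).

Definition vunit i : seq trit := ncons i T0 [:: T1].

(* Base 4, least significant digit first; the leading digit 1 only marks the end. *)
Fixpoint trits_of_pos (p : positive) : seq trit :=
  match p with
  | xO (xO p') => T0 :: trits_of_pos p'
  | xI (xO p') => T1 :: trits_of_pos p'
  | xO (xI p') => T2 :: trits_of_pos p'
  | _ => [::]
  end.

(** An absent word is looked up as the empty list, the zero vector; this is how basis words drop out
    of a relation. *)
Inductive trie := Trie of seq trit & seq trie.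

Fixpoint trie_find (w : seq nat) (t : trie) : seq trit :=
  let: Trie v ts := t in
  if w is s :: w' then trie_find w' (nth (Trie [::] [::]) ts s) else v.

Fixpoint trie_insert (w : seq nat) (x : seq trit) (t : trie) : trie :=
  let: Trie v ts := t in
  if w is s :: w' then
    Trie v (set_nth (Trie [::] [::]) ts s (trie_insert w' x (nth (Trie [::] [::]) ts s)))
  else Trie x ts.

(** Every letter, 0 included, costs at least 1, so fuel k reaches all words of weight k. *)
Fixpoint words_fuel (f k : nat) : seq (seq nat) :=
  if k is 0 then [:: [::]] else
  if f is f'.+1 then
    flatten [seq [seq s :: w | w <- words_fuel f' (k - maxn s 1)] | s <- iota 0 k.+1]
  else [::].

Definition words_of_weight k := words_fuel k k.

(** Words grow at the front, in the same order as the iterated sums of [coef_table]. *)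
Fixpoint words123 (f k : nat) (w : seq nat) : seq (seq nat) :=
  w :: if f is f'.+1 then
         flatten [seq words123 f' (k - s) (s :: w) | s <- [:: 1; 2; 3]%N & (s <= k)%N]
       else [::].

Fixpoint lexle (v w : seq nat) : bool :=
  match v, w with
  | [::], _ => true
  | _, [::] => false
  | x :: v', y :: w' => (x < y)%N || (x == y) && lexle v' w'
  end.

(* The words in 1, 2, 3 of weight at most 7 that are dependent on the others. *)
Definition redundant_words : seq (seq nat) :=
  [:: [:: 3; 2; 1]; [:: 2; 2; 2; 1]; [:: 3; 1; 2; 1]; [:: 3; 2; 1; 1]].

(* [relations k] lists quadruples (a, b, da, db), standing for the equality of the
   product of a and b with the product of a or its dual (if da) and b or its dual
   (if db).  In weight k this gives a square integer matrix, with one column for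
   each dual pair outside the basis, in the order of [pivot_words k]; the entries
   of [inverse k] encode the rows of its inverse modulo 3. *)
Definition relations3 : seq (seq nat * seq nat * bool * bool) := [::
   ([:: 1], [:: 1; 0], false, true)]%N.

Definition inverse3 : seq positive := [::
   5]%positive.

Definition relations4 : seq (seq nat * seq nat * bool * bool) := [::
   ([:: 1], [:: 1; 0; 0], false, true); ([:: 1], [:: 1; 0; 1], false, true);
   ([:: 1], [:: 1; 1; 0], false, true); ([:: 1; 0], [:: 1; 0], true, true);
   ([:: 1; 0], [:: 1; 1], true, false)]%N.

Definition inverse4 : seq positive := [::
   321; 1556; 1312; 322; 1568]%positive.

Definition relations5 : seq (seq nat * seq nat * bool * bool) := [::
   ([:: 1], [:: 1; 0; 1; 0], false, true); ([:: 1], [:: 1; 0; 0; 0], false, true);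
   ([:: 1], [:: 2; 0; 0], false, true); ([:: 1], [:: 1; 0; 0; 1], false, true);
   ([:: 1], [:: 1; 1; 0; 0], false, true); ([:: 1], [:: 1; 0; 1; 1], false, true);
   ([:: 1], [:: 1; 1; 0; 1], false, true); ([:: 1], [:: 1; 1; 1; 0], false, true);
   ([:: 1], [:: 1; 2; 0], false, true); ([:: 1; 0], [:: 3], true, false);
   ([:: 1; 0], [:: 1; 0; 1], true, true); ([:: 2], [:: 1; 0; 1], false, true);
   ([:: 2], [:: 1; 1; 0], false, true); ([:: 1; 0], [:: 1; 1; 0], true, true);
   ([:: 1; 0], [:: 2; 1], true, true); ([:: 1; 1], [:: 1; 0; 0], false, true);
   ([:: 1; 0], [:: 2; 0], true, false)]%N.

Definition inverse5 : seq positive := [::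
   23757128273; 6443892873; 5369299077; 6447309318; 5369102728; 5385846921; 5436211850; 109073728;
   6443630849; 1363241601; 7005087109; 5370347588; 22616080538; 6443041349; 6511919753;
   5645927690; 23690019173]%positive.

Definition relations6 : seq (seq nat * seq nat * bool * bool) := [::
   ([:: 1], [:: 1; 0; 0; 1; 0], false, true); ([:: 1], [:: 1; 0; 1; 0; 0], false, true);
   ([:: 1], [:: 1; 0; 1; 0; 1], false, true); ([:: 1], [:: 1; 0; 1; 1; 0], false, true);
   ([:: 1], [:: 1; 1; 0; 1; 0], false, true); ([:: 1], [:: 2; 0; 0; 0], false, true);
   ([:: 1], [:: 1; 0; 0; 1; 1], false, true); ([:: 1], [:: 1; 1; 0; 0; 1], false, true);
   ([:: 1], [:: 1; 1; 1; 0; 0], false, true); ([:: 1], [:: 1; 0; 1; 1; 1], false, true);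
   ([:: 1], [:: 1; 1; 0; 1; 1], false, true); ([:: 1], [:: 1; 1; 1; 0; 1], false, true);
   ([:: 1], [:: 1; 1; 1; 1; 0], false, true); ([:: 1], [:: 1; 0; 0; 0; 0], false, true);
   ([:: 1], [:: 1; 0; 0; 0; 1], false, true); ([:: 1], [:: 1; 0; 2; 0], false, true);
   ([:: 1], [:: 1; 1; 0; 0; 0], false, true); ([:: 1], [:: 1; 2; 0; 0], false, true);
   ([:: 1], [:: 1; 3; 0], false, true); ([:: 1], [:: 2; 0; 1; 0], false, true);
   ([:: 1], [:: 2; 1; 0; 0], false, true); ([:: 1; 0; 0], [:: 3], true, false);
   ([:: 1; 0], [:: 4], true, true); ([:: 1], [:: 1; 1; 2; 0], false, true);
   ([:: 1], [:: 1; 2; 1; 0], false, true); ([:: 1; 0], [:: 4], true, false);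
   ([:: 1], [:: 1; 0; 0; 2], false, true); ([:: 1; 0], [:: 3; 0], true, true);
   ([:: 1; 0; 1], [:: 3], true, false); ([:: 1; 1; 0], [:: 3], true, false);
   ([:: 2], [:: 1; 0; 0; 1], false, true); ([:: 2], [:: 1; 1; 0; 0], false, true);
   ([:: 1], [:: 1; 0; 2; 1], false, true); ([:: 2], [:: 2; 0; 0], false, true);
   ([:: 2], [:: 1; 0; 1; 0], false, true); ([:: 2], [:: 1; 0; 1; 1], false, true);
   ([:: 2], [:: 1; 1; 0; 1], false, true); ([:: 2], [:: 1; 1; 1; 0], false, true);
   ([:: 1; 0], [:: 1; 3], true, false); ([:: 1; 0], [:: 3; 1], true, false);
   ([:: 1; 0], [:: 1; 0; 1; 0], true, true); ([:: 1; 0], [:: 1; 0; 1; 1], true, true);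
   ([:: 1; 0], [:: 1; 1; 0; 1], true, true); ([:: 1; 0], [:: 2; 0; 0], true, true);
   ([:: 1; 0], [:: 1; 1; 1; 0], true, true); ([:: 1; 0], [:: 1; 1; 1; 1], true, false);
   ([:: 1; 0], [:: 1; 2; 1], true, true); ([:: 1; 1], [:: 1; 0; 1; 0], false, true);
   ([:: 1; 0], [:: 1; 0; 0; 1], true, true); ([:: 1; 0], [:: 1; 0; 2], true, false);
   ([:: 1; 0], [:: 2; 0; 1], true, true); ([:: 1; 0], [:: 2; 1; 1], true, true);
   ([:: 1; 0; 0], [:: 1; 0; 1], true, true)]%N.

Definition inverse6 : seq positive := [::
   6419454896950654584085955633832; 124411138353190025546115978793609;
   124252682028161496870928890892936; 104047029157563500281965915953698;
   103017694945839260393420164260890; 101511468758650288593944468128; 1964878374220362919445509;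
   123161767545961956321313898916358; 102243943725398664870553859523994;
   7787283962816799793257686406785; 99035203733126232626587238437; 100273533470909595799196815465;
   121318509171404578360932997192; 121318513558476824204357685785;
   124252681650371744769893005169281; 104681779296404776836573571867237;
   123460419745318195510137778903202; 1605978303906534551323017; 7092197181401082818441363742790;
   123141960127101138112020586455312; 123122616482850762882018845549220;
   123774197265779490823430561874026; 123161767923239012700008543250761;
   99035580942100469967585543525; 99035600515173939828765098089;
   123458562461234813874357331912720; 125142711796045620531200; 123163010695725798230531191882149;
   109144861788535289109805185472129; 133294307174391192136514716047880;
   123140727767645151919343245763912; 6360556859131380572328475120776;
   1921605195419239631838160901768; 6190466406447959293455525026;
   123122428117100206240926797503080; 109415350113506455393894260024854;
   109761047673400087777015598433698; 123460419745169536714575819608453;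
   103969944427601890261883020400264; 121654816781928634186574596242;
   103947661121580884346467585657088; 124252837601443057066165250988682;
   124252681272222790850748143278724; 124252682858938146393630888598154;
   104663209814923665741731762313301; 123459181808743878110450453864730;
   102048526086573239792387395688528; 123140722931944760957209162088805;
   1607199864590927332766934010184; 1615824440795543714239010459733;
   102701092535996182621648592660498; 102721055981997708813659853646152;
   2020495025374830720301242796438]%positive.

Definition relations7 : seq (seq nat * seq nat * bool * bool) := [::
   ([:: 1], [:: 1; 0; 1; 0; 1; 0], false, true); ([:: 1], [:: 1; 0; 0; 1; 0; 0], false, true);
   ([:: 1], [:: 1; 0; 0; 1; 0; 1], false, true); ([:: 1], [:: 1; 0; 0; 1; 1; 0], false, true);
   ([:: 1], [:: 1; 0; 1; 0; 0; 1], false, true); ([:: 1], [:: 1; 0; 1; 1; 0; 0], false, true);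
   ([:: 1], [:: 1; 1; 0; 0; 1; 0], false, true); ([:: 1], [:: 1; 1; 0; 1; 0; 0], false, true);
   ([:: 1], [:: 1; 0; 1; 0; 1; 1], false, true); ([:: 1], [:: 1; 0; 1; 1; 0; 1], false, true);
   ([:: 1], [:: 1; 0; 1; 1; 1; 0], false, true); ([:: 1], [:: 1; 1; 0; 1; 0; 1], false, true);
   ([:: 1], [:: 1; 1; 0; 1; 1; 0], false, true); ([:: 1], [:: 1; 1; 1; 0; 1; 0], false, true);
   ([:: 1], [:: 2; 0; 0; 0; 0], false, true); ([:: 1], [:: 3; 0; 0; 0], false, true);
   ([:: 1], [:: 1; 0; 0; 1; 1; 1], false, true); ([:: 1], [:: 1; 1; 0; 0; 1; 1], false, true);
   ([:: 1], [:: 1; 1; 1; 0; 0; 1], false, true); ([:: 1], [:: 1; 1; 1; 1; 0; 0], false, true);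
   ([:: 1], [:: 1; 0; 1; 1; 1; 1], false, true); ([:: 1], [:: 1; 1; 0; 1; 1; 1], false, true);
   ([:: 1], [:: 1; 1; 1; 0; 1; 1], false, true); ([:: 1], [:: 1; 1; 1; 1; 0; 1], false, true);
   ([:: 1], [:: 1; 1; 1; 1; 1; 0], false, true); ([:: 1], [:: 1; 0; 0; 0; 1; 0], false, true);
   ([:: 1], [:: 1; 0; 0; 2; 0], false, true); ([:: 1], [:: 1; 0; 1; 0; 0; 0], false, true);
   ([:: 1], [:: 1; 0; 2; 0; 0], false, true); ([:: 1], [:: 1; 0; 3; 0], false, true);
   ([:: 1], [:: 1; 2; 0; 0; 0], false, true); ([:: 1], [:: 1; 3; 0; 0], false, true);
   ([:: 1], [:: 1; 4; 0], false, true); ([:: 1], [:: 2; 0; 0; 1; 0], false, true);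
   ([:: 1], [:: 2; 0; 1; 0; 0], false, true); ([:: 1], [:: 2; 1; 0; 0; 0], false, true);
   ([:: 1], [:: 2; 2; 0; 0], false, true); ([:: 1; 0], [:: 5], true, false);
   ([:: 1], [:: 1; 0; 0; 0; 0; 0], false, true); ([:: 1; 0], [:: 5], true, true);
   ([:: 1; 0; 0], [:: 4], true, true); ([:: 1], [:: 1; 0; 0; 0; 0; 1], false, true);
   ([:: 1], [:: 1; 1; 0; 0; 0; 0], false, true); ([:: 1], [:: 1; 0; 0; 0; 1; 1], false, true);
   ([:: 1], [:: 1; 0; 1; 2; 0], false, true); ([:: 1], [:: 1; 0; 2; 0; 1], false, true);
   ([:: 1], [:: 1; 0; 2; 1; 0], false, true); ([:: 1], [:: 1; 1; 0; 0; 0; 1], false, true);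
   ([:: 1], [:: 1; 1; 0; 2; 0], false, true); ([:: 1], [:: 1; 1; 1; 0; 0; 0], false, true);
   ([:: 1], [:: 1; 1; 2; 0; 0], false, true); ([:: 1], [:: 1; 1; 3; 0], false, true);
   ([:: 1], [:: 1; 2; 0; 0; 1], false, true); ([:: 1], [:: 1; 2; 0; 1; 0], false, true);
   ([:: 1], [:: 1; 2; 1; 0; 0], false, true); ([:: 1], [:: 1; 2; 2; 0], false, true);
   ([:: 1], [:: 1; 3; 1; 0], false, true); ([:: 1], [:: 2; 0; 1; 1; 0], false, true);
   ([:: 1], [:: 2; 1; 0; 1; 0], false, true); ([:: 1], [:: 2; 1; 1; 0; 0], false, true);
   ([:: 1; 0; 0], [:: 4], true, false); ([:: 1], [:: 1; 0; 0; 0; 2], false, true);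
   ([:: 1], [:: 1; 1; 1; 2; 0], false, true); ([:: 1], [:: 1; 1; 2; 0; 1], false, true);
   ([:: 1], [:: 1; 1; 2; 1; 0], false, true); ([:: 1], [:: 1; 2; 1; 1; 0], false, true);
   ([:: 3], [:: 2; 0; 0], false, true); ([:: 3], [:: 1; 0; 0; 1], false, true);
   ([:: 3], [:: 1; 0; 1; 0], false, true); ([:: 3], [:: 1; 1; 0; 0], false, true);
   ([:: 1], [:: 1; 0; 0; 1; 2], false, true); ([:: 1], [:: 1; 0; 0; 2; 1], false, true);
   ([:: 1], [:: 1; 0; 1; 0; 2], false, true); ([:: 1], [:: 1; 0; 3; 1], false, true);
   ([:: 2], [:: 2; 0; 0; 0], false, true); ([:: 2], [:: 1; 0; 0; 1; 0], false, true);
   ([:: 2], [:: 1; 0; 1; 0; 0], false, true); ([:: 2], [:: 1; 0; 0; 1; 1], false, true);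
   ([:: 2], [:: 1; 1; 0; 0; 1], false, true); ([:: 2], [:: 1; 1; 1; 0; 0], false, true);
   ([:: 1], [:: 1; 0; 1; 2; 1], false, true); ([:: 1], [:: 1; 0; 2; 1; 1], false, true);
   ([:: 1; 0], [:: 4; 0], true, true); ([:: 1; 0; 1], [:: 4], true, false);
   ([:: 1; 1; 0], [:: 4], true, false); ([:: 3], [:: 1; 0; 1; 1], false, true);
   ([:: 3], [:: 1; 1; 0; 1], false, true); ([:: 3], [:: 1; 1; 1; 0], false, true);
   ([:: 1; 0], [:: 2; 3], true, false); ([:: 1; 0], [:: 3; 2], true, false);
   ([:: 2], [:: 1; 0; 1; 0; 1], false, true); ([:: 2], [:: 1; 0; 1; 1; 0], false, true);
   ([:: 2], [:: 1; 1; 0; 1; 0], false, true); ([:: 2], [:: 1; 0; 1; 1; 1], false, true);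
   ([:: 2], [:: 1; 1; 0; 1; 1], false, true); ([:: 2], [:: 1; 1; 1; 0; 1], false, true);
   ([:: 2], [:: 1; 1; 1; 1; 0], false, true); ([:: 1; 0], [:: 1; 4], true, true);
   ([:: 1; 0], [:: 4; 1], true, true); ([:: 3], [:: 1; 2; 0], false, true);
   ([:: 1; 0], [:: 2; 0; 2], true, true); ([:: 2], [:: 1; 0; 0; 0; 1], false, true);
   ([:: 2], [:: 1; 0; 0; 2], false, true); ([:: 2], [:: 1; 0; 2; 0], false, true);
   ([:: 2], [:: 1; 1; 0; 0; 0], false, true); ([:: 2], [:: 1; 2; 0; 0], false, true);
   ([:: 2], [:: 1; 3; 0], false, true); ([:: 2], [:: 2; 0; 1; 0], false, true);
   ([:: 1; 0], [:: 3; 0; 0], true, false); ([:: 1; 0; 0], [:: 3; 1], true, true);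
   ([:: 1; 0; 0], [:: 3; 0], true, true); ([:: 1; 0], [:: 3; 1; 0], true, true);
   ([:: 1; 0], [:: 1; 0; 1; 0; 1], true, true); ([:: 2], [:: 1; 0; 2; 1], false, true);
   ([:: 2], [:: 1; 2; 1; 0], false, true); ([:: 1; 0], [:: 1; 0; 3], true, true);
   ([:: 1; 0], [:: 3; 0; 1], true, true); ([:: 1; 0; 0], [:: 1; 3], true, true);
   ([:: 1; 0], [:: 1; 0; 1; 1; 0], true, true); ([:: 1; 0], [:: 1; 0; 1; 1; 1], true, true);
   ([:: 1; 0], [:: 1; 3; 0], true, true); ([:: 1; 0], [:: 2; 2; 0], true, true);
   ([:: 1; 0], [:: 1; 1; 0; 1; 0], true, true); ([:: 1; 0], [:: 1; 1; 0; 1; 1], true, true);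
   ([:: 1; 0], [:: 1; 1; 3], true, false); ([:: 1; 0], [:: 1; 3; 1], true, false);
   ([:: 1; 0], [:: 3; 1; 1], true, false); ([:: 1; 0], [:: 1; 2; 2], true, true);
   ([:: 1; 0], [:: 2; 1; 2], true, true); ([:: 1; 0], [:: 2; 2; 1], true, true);
   ([:: 2; 0], [:: 2; 0; 0], false, true); ([:: 1; 0], [:: 1; 1; 1; 0; 1], true, true);
   ([:: 1; 0], [:: 1; 0; 0; 1; 0], true, true); ([:: 1; 0], [:: 2; 0; 0; 0], true, true);
   ([:: 1; 0], [:: 1; 0; 0; 1; 1], true, true); ([:: 1; 0], [:: 1; 1; 1; 1; 0], true, true);
   ([:: 1; 0], [:: 1; 1; 1; 1; 1], true, false); ([:: 1; 1], [:: 2; 0; 0; 0], false, true);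
   ([:: 1; 0], [:: 2; 0; 0; 1], true, true); ([:: 1; 1], [:: 1; 0; 0; 1; 0], false, true);
   ([:: 1; 1], [:: 1; 0; 1; 0; 0], false, true); ([:: 1; 0], [:: 1; 0; 0; 2], true, true);
   ([:: 1; 0], [:: 1; 2; 0; 0], true, true); ([:: 1; 0], [:: 1; 0; 1; 1; 1], false, true);
   ([:: 1; 0], [:: 1; 1; 0; 0; 1], true, true); ([:: 1; 0; 1], [:: 1; 3], true, false);
   ([:: 1; 0], [:: 1; 0; 1; 2], true, false); ([:: 1; 0], [:: 1; 0; 2; 1], true, true);
   ([:: 1; 0], [:: 2; 0; 1; 1], true, true); ([:: 1; 0], [:: 1; 1; 0; 1; 1], false, true);
   ([:: 1; 0], [:: 1; 1; 1; 0; 1], false, true); ([:: 1; 0; 0], [:: 2; 0; 0], true, true);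
   ([:: 1; 1; 0], [:: 2; 1; 1], true, true); ([:: 1; 0; 0], [:: 1; 0; 1; 1], true, true)]%N.

Definition inverse7 : seq positive := [::
   48892846935333425747986839190230472902808791526450834820288119583581967938300388683661967705;
   49052017030140032257777668144623684986914652713823428970014198155332430659464434175621898920;
   48892913107522354737176666822711573050972672993789487307334577628346698341292347938171797656;
   828543138220714133629434976446953765661295267130813724461868401176154187473356578054580242;
   660159344876408283821919078466178752166165976761869692141133111312183174689194905990272255065;
   48890903963162359786453759225332353972519058314024480909381610355545874525467512139325391145;
   790531667131477829574548362687977564590172535248041500107800464601607176823197616446496179585;
   668311460993374535327803539759664840758654675358491932692168343186437443440835520973014476326;
   159147361070608401138273833720367728582016131886312150630013834917896710260944121759138824;
   773845658626913358151112128291779102540746769765984528370685895395155743211552740407071898;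
   798841374650051426416154032309731572316874570499760820010778900240917835694974968931940634881;
   782477511678574298069321399219547724093307284986466677951785532243110472772315152672707908133;
   668311484730210979899500636857081683647111698277080865118380176655542356544251633152385778193;
   40740723473037258045392841518235616479787744354390050737629793196183692937918396571303575945;
   2428336115282161338649327383529398633305863044200586321326882084186321952573648535589;
   832063250923900661391075022329041187399222596253357319851315154564404975291265508413344005;
   12627348426388783461527996332947320378572141391174766506641658067367011768153109714470;
   12627348426388783461521356464949974726384249255478814202487988559113350696693664335013;
   790642574200031066381792580289740828120132098628801956223831362025505694671718640740057061700;
   48890903963162359786426151818696025043140572498903686743954765979494373353520410725957255461;
   790693293486582652484013206597774764856068986655528353693977429435839094867403514659479063050;
   48888926751188454054229456261094943240102561816950759516056386946898414279527856231873012288;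
   651981396427543947925902452958563454981084324529536473086311661198058912282523945909570131218;
   652042986041112838020757120951653053918766040817100395792817341037764823234690189998630260997;
   48890933042340921221991226247182463757283407013055837679209055763899750261427987868452657825;
   798777746328289127201380761605760330388199930292361356552056177712498365766715183237843722756;
   12008729353121427726098708447678790728294150281293026565075343583346553482774552925733394;
   40900423491134924837829821236216116453575164736784007071461921140457985871060440003902054918;
   652015174670057354129353696582306565003902633861706598159427840891726104853830746478937253121;
   764388501777951807218002476755504030467317452773126178328861890847983740686547636259489428;
   3068490420435118247419236050212336512002695364978961958955480135683639523411076;
   652013224594737356064364486510771184122638962541498425440001403661650996042764061540192229798;
   48892916992978565558516404871444349917522109498813382946989373410577403707986303877180818778;
   194991781820329596760328887596264137483675198745602383922521085471332521717049700441393738;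
   832064639628790276483015598163211053985042724273948283872043495274829732904303895562787368;
   671465292570948604559554293193754417655424013346515792974562893871647095871273351872086150;
   671465292570948604559662123820474836434713176331052267302585360450451500548103155591839764;
   790531670531147773562535812824462113786511719168769277247859883543984489863720838737297035360;
   660274244963763902422030226528955765099097504365548332718900253420103682058173712494851954008;
   798845414059785645016699684600071231406283076750714895931968683388774801402876353437845721418;
   161211590947148949459372546532245514368863753715156234598525903452296634708990535332827818;
   49192280162618051721214538121759741997860963471559381961399160233644830456159747877822112168;
   637572434489974965558899523836638069317252575646612605250531831765737107130722740435849362;
   12006817039299080161796139867629749271815321186619070519159918354883884734433632609912986;
   790529602286803943923670274410589016730655793670496662788971792688112893904938364437271307601;
   2460581896400818202337699196238797901663608833662039220919945159953892576854016;
   652060966132291360108700326467789869829864332342023794972873679105726938467028228279847180808;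
   798773805833273800944825604529712118044590344472906857750138254522641785302940880177426931860;
   652174781409819024761992571824042115581433557119293722298158894629931308860291502612445218214;
   782270074012467234681651996792007787844894142756040662342468047569692937286885448636186116514;
   651872447159472074439299732112460763069333483189723331526322688170445833494089590405355428197;
   194992753154775699085887619265807823976130951075383271070151822297487132306670675550017109;
   40774537571510054586403796390657691193008047146833355102092812729297115636907275412284907526;
   782477441137307286675412083280119671341607982816920169840727943672448676267545018255153666630;
   48892851792124690601221112108427485909436401997698343101156119916042732380639214094197498498;
   798725517727294906187472970682333521418732327325266232684190182244542461663281813146200326809;
   40878540267030675893893963580974554141315031291520243820118784085448668532151440250954716580;
   651981393938499429756317532943060238053822140360518622917181100312498534778160801979092837034;
   48892881144484638555683135630334165113118305436116959950675959914805136795594936420946430026;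
   48924748594197845288682425349927947592673933146658946874923803588219574793919319759524987905;
   48888914184282407795125198602979532846618239711609840008847597870843348136378720432064332161;
   41059534850685335334749384489107163597635835626019069209143107619275028623691810417994432904;
   40744706884948234819310302217433188738629303060952004137368373103021554342892864515336067092;
   652126076875732628156853882600009533029307741727775723107906281762737328474495448554781968465;
   782545114431313789077297560325130227751497731055174249367008445207181115230696813132250431585;
   652013222166374087597350560916120563204007406914393029337201103260156250485054299912517883398;
   48888898703673194623159399446461848729579153207018630058395925512990675692277402842112758153;
   652013224594737529752525518519692041867486179778825888189923622713583626071476052418039015785;
   782545116859622577412259492208577804771605349000833519494496175953184282374608844127663919642;
   782349134528374814889549621548472881234474774938361306448978971470710787877936720150578992458;
   798283492241152030429434973062008691703310761515817379615882667241712774888634088590495909;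
   48890933527919881747540619227294251341528809884396802522659641339709924298596207988102407764;
   798713071442453384530673896898370935787745705591800222091394818411825550380900982866399856280;
   790370503433644057250086166093078467148678866199628421603614410618513585173307430254451639368;
   194993724489395500028310663322629493092255254851758579541077705637753767223743943043745161;
   40776547262238467426736608303686213882206866998867950719920169810519861282491508773806432664;
   40742717136809831781861061902531283990420774844561211878674292823299655024259129215088104484;
   652114116658414829615868303775490947924208644701520543671636762611264549186139750491391076630;
   652015172727388461903624625662844658180383727207881777565640640591447407064092523010766546440;
   782511335975998688593334164917240062830193754980250645949790212581474792571892832969239630930;
   652047011643968899456828746694278072730243091808909525915537291181466431343013668851905349029;
   41781958426167593834281973348226029582181303802512267018240;
   782479508243243796349879394420533478008295848986638547339708705450901474632749745490701586688;
   651983466470249456497238156552738317276865774517504947261969932453550485576952400825324939940;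
   782541345775110319288857624536961697921413505264390198894538528863053293323448449525157478421;
   782285970354281252069041921286051956660177947014065072010700611445110843588987552493157638466;
   40741249094806897544708993071212439474755853888774518235163676327950796409000120794594576804;
   847975156439290150044240354055569885618149560282821296176007290951186207159847620521859157;
   782511335960821578374196052792825159546008738392322745156130878465856173184760671319946731522;
   689537799559004451605641684985283139934781050336371125275305409958902144641220418372702443156;
   782380961263060535466190559483520404213290855934519955953543193680303998687665633337786000984;
   688816719373845324486852653637932928443342819213277653309474967097312995259678724480466306466;
   689236998017721861020436105122646959314468212985964957482496984800021059187913493546835005525;
   652116171138750475609056223524472043127590585225726543887829189515180568691764751836980974985;
   193039246997669740147708745203669177444319716940429605329441772968085317247998458907896149;
   206891370751751267348817114166099526181262618382166280772838542679061789919823533968998529;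
   10028180414509760390467526562050824126255335995072924762110673728635397817836140451403018;
   669401614472651298568011182321145086185813920651266867970819308526143730989500249222243749;
   668151853647806230799529977160380821203816851845386023924181693510584834630820243802859506261;
   782254656839091119102035884314292121907518372317171042003334097274017742034551151899081794724;
   830579389407693536605291052004688708444012609976240062321225543237600592092051844260791913;
   660003674076253803116246313649687352947127249538018724689426584359766728581686493335531839817;
   668478035564822867185919690451843668193216581518591725328154558519012825323566660832023177638;
   40950607580240168833538851165046701673700116948404157258807565453084094373645032101018996760;
   668474111502695224610666401597210373243917977174701030090736047799904095087866453934518667858;
   660020594702771311378740055583009426698445244132102792038178724566534653793638837902864193706;
   40877025952871753371150757066312717723073107485562808933125413716755768123539925427602679378;
   782285972774967254522738780209477147445904367422855930384190256411016741476714266389117540948;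
   668315468106373686338352976032288027187040062320523462974258970795091267124747279835255051793;
   684576052742047487707377235328944174885596332833967052139764653083624783929015027980248066200;
   165273015467494817685482228715830531101222742216566452627551495124935495706241348815825473928;
   49037070261012436416001683111201057855973330084950905709053403342409192505577240997556527754;
   660004143171867919559743697133444746159064266538929185763888747655587491148618916277654656341;
   798789721618601360140330235225984592634482568364345503428993907508810405156992525738994328228;
   832529980835554909767758496909369779812937534729478648861479447448491371558214190117505697;
   668469118416764020519831901030836162320894195359161282931907056407821492153792612559240890452;
   798837401892411219557985735770824628404525714996618294550902198370037784572166676568182432105;
   790534083449095051110153497215786955289224628673140501194358964928553870797018374714683983493;
   790390364796044001822720125554589511797894599451799547775282602298209410023605478826914646401;
   49057028937447013120674292090877189550100366158485782076682497108867915765386111548092057732;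
   830576930929720048674349084606416694447740298878732225188641236119274375715018840430974372;
   670907175512015746486407594442875136293959003856491698799958365368604510840714652369443476;
   40915819213749708233118675145202346592207467415705616412036844052957856835235484352189376026;
   828541044136228548704847530851651560282115508147238366524304260151175072372919184177563050;
   40740721499863489885366212433465171431195827507700729559779294235041013325246422569352970826;
   48888929604454200430450299330003652922740633824371931805314786371854522908609072314043113865;
   40740723473037258045337627968710458643717013099163781934485019545309316016493233034942775685;
   652015205631489185214790022457190497152650661173889029461723626450014510445129790467072467200;
   48888895729079706066457840222891281146822728514557820921562444913251204728299643784950448208;
   9966377233554534124622969960125202301127240029814363931237141610165996482864619498529065;
   782545116859684178773672652710790428146573545992302757438949728538937496111222607376589099536;
   660159363665810692448606737015953035269485643953384307155568682459832988000343525991075452265;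
   40740763511857313927688865170890217369097166275989456369603059974299410825804265831264179609;
   40940676990778681677001845327092520647112800967736311161633335331102722200390912373382841377;
   40740751338162685424524546721253847887120291516183414678830782676052998665261531467693958313;
   798693238341064822172093230977630778767438542080625865562163700590005742948143021256455383552;
   798518106730586560085140687562106410518676701187023831844439799899815166302568527606883320965;
   40902427779083520350753165291790725219541923265378392499773159071836520499490665607889291280;
   668469087212678746317217454843365085208101932221062220230018582670940382227791792639361522344;
   790541115847952982594455923153652153347159661523966577319226309277321259597378865867319317157;
   645094426992176260956910238288382024376305552948003315924297003417942262191656251145169160;
   782383029921002766717033829637385854795715466945820218119273859274840967952869715964291547520;
   790390423448404806724203420172077930107427478563980067784972489293545405467446335593556090962;
   164191330882708440537954937148128239364172622205787830967569197397593654707563842586494390809;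
   782511307564436786483300862317113750650373201526949886171026846688296672059069914113925026178;
   798837417827854856480815572629041080618982913197406348023296980613378584912833927329546065445;
   651979326726344868189418223147783520606484276981187895933789580734414473001564707606906967686;
   652110688301196081509471294820298637852325469087108972237898227047961741550721247464461276512;
   40744740183742447233915404803455335699642916368297406033197843391076398545453026501560672786;
   40744740183746152580770998711084306634048820985512655305366279251335470387043057213087195666;
   48892914078941879114247758527548222032233332415283703535858559851658325311616544923115886216;
   782385442552711382130395045422313476247660374788024328937198096570163908607191524808462043137;
   804234006135398851894895114321753425208764723478959446410210639602652863669654604760819042;
   782543164173846431278794712743368208582911630546018298754776206202988935670655411603146899561]%positive.

(* [sample_inverse] encodes the rows of the inverse modulo 3 of the matrix of the
   coefficients of q^n, for n in [sample_degrees], of the 92 basis words. *)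
Definition sample_degrees : seq nat := rcons (iota 0 91) 92.

Definition sample_inverse : seq positive := [::
   5; 20; 40641287728529852441839882267136529461375727287524692104;
   8652584190974811074669749892457223247126275962108660232;
   32719176820924274338481035723058118121721905462312501864;
   7771133455346202446865074142563428741520899733672249888;
   9677269333948882419889862152215489195822816680404395648;
   2167541869460244029711793367197685397414802774604466240;
   33738979051772077358132864758577540377615168025813207680;
   2348555033831969561094146910681614966259536886019297800;
   37561885624855507246598522394226211145517833555404015876;
   9779016192599751075755889046838205919348393807148373160;
   8243165403256241492005618883705214667592270347331852576;
   36973700527189926008193252073099526622239514540313844136;
   30904366405363889830974144611657332393399914712611031556;
   34221122701490885112350155955721316734984487047126386848;
   7812182271625977495929615550856539659423475386663588512;
   37702581836476863689275624714216826129292495261905592912;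
   31512416885780606846162525231300759785498901715304317320;
   9318307050749640565943100630922939664726328720707159128;
   33171832191516546559148358491579705952813211546890076196;
   37546564952969614956735199240795721379434130543904719908;
   32597381486527240655279402544789725471530511280592404820;
   2503963834677154376588547764884284378479334263942719656;
   2071407607346249828091366063003044326162191552111579216;
   33771049321655365736187239403009928201766166296470751528;
   31084424891586299785957051661756784610798977348195949160;
   34107620681552240001229626350967219755761674942440375328;
   2051156269651551515090684947367457404193610368271582800;
   37289691188212091363085577264592500283233479378495408776;
   9706163247182623163390531084837998890968937687987410020;
   32604454828409691761041088411925180482758658833311089176;
   38318598632136766520510763785485452443261598230583478884;
   2347245164781089292202619074997258502875668208928003076;
   34674635554225879130907534688159635265770316249115697748;
   32214457834127961194563335391485553352840986551021609048;
   37643518176602840751668076051154469306592479203256456484;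
   9819292071247899149647365514513760452133011734953036328;
   2122395607016479551473020054802381727190112928685199704;
   39094026661512430137255605048270132094449296079831000712;
   588916615656853879837361098822688764247736935896351108;
   31287842184220864318911722421202851710869108510421576040;
   31034566371326206957854765014970250301961496294817154324;
   2164993312846781396826787390499678472026094010840271456;
   2395116289449051673331910445819118313077350673888190496;
   32578488147183113243144730175677864575986115270236737604;
   33816695877853764605950883442732892444466404064115627272;
   2043256230543893119257931374061822505255986169259856960;
   37190107479168753246336095991771880411879842586690887680; 84;
   40641287728529852441839882267136529461375727287524692388;
   32616514786535715921133633056103554768876187560178968744;
   2312798028264099025576530142012333734400523672151408804;
   2361800773294117911232443048928301242161167716890190216;
   36884782224585445908373653075336370388113002662458659472;
   30689784357902311739595324762042935980950624075081992264;
   9617608308201452220084564825634449598896455713429227520;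
   36815998679872244552906358101902155679703544987126245544;
   37283610535733783679575674563828751477581532198782114368;
   34535149749028796524192216347679234740449893410308170280;
   30652163094995346937289709875072130386460252843074408864;
   39871181719729486412645219356872973472711536326784205120;
   9832530165090121362211788281136233301192656950195655264;
   9354220167936352744947780796032761412025564631360225940;
   8454963097326967410219345085957343741372601639896654244;
   9737344761311533012263833054919789758507213179639599188;
   30713008606529827732205617459457848978842095683780121952;
   10186585345977133917766495395890868549359701148331055712;
   152091624792139130841906499296964355229189118632167076;
   8238812895726419562318902965901693770197687000041525536;
   2505887813403108412922139064900408164513392756038870292;
   2146655492654733420640911410716441106302499077161636240;
   32676710113533959478983326342069430761286296001434949220;
   38346272844122385613758853055196539329136476830579335192;
   40625397014148446867666160851490593777147295505934616744;
   38827618331151020267042865068879072627648006494614995496;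
   7869989610060983361806544026602075594463581483716464912;
   32625542792090764504667395800055039693000217067428012176;
   9770048800542863228052780286015208362525624075472509216;
   7857139503796936880736016661767352122018039434022490448;
   37583789499066546726184638338926046269145512587755356672;
   39135532678747461779204493789479804690637458360565784968;
   37176969311367859649198158913084557436534171279447984264;
   32789140910768415657466006770908381824218583173781825156;
   8623843802497073347982721756827719442497549403261248608;
   39854338577300087838838223224948356030751548341156860036;
   38914445723634440150047330038607607321925251580651722376;
   31657248289388181070170068627548537328545563603799217156;
   33820517916242087471522042946834304151473803166170514772;
   31070581279276005677819771594142200013837968558075828776;
   32425726039902222568585084317649932783717228574388169096;
   31452684919317922672473078091224671702710872337470237192]%positive.

Definition basis_words : seq (seq nat) :=
  [seq w <- words123 7 7 [::] | w \notin redundant_words].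

(** The unknowns of the linear system in weight k: one representative of each dual pair that does
    not meet the basis. *)
Definition pivot_words k : seq (seq nat) :=
  [seq w <- words_of_weight k | [&& admw w, lexle w (dual w), w \notin basis_words &
                                   dual w \notin basis_words]].

Definition relation := (seq nat * seq nat * bool * bool)%type.

Definition rel_left (r : relation) := let: (a, b, _, _) := r in stuffle a b.

Definition rel_right (r : relation) :=
  let: (a, b, da, db) := r in
  stuffle (if da then dual a else a) (if db then dual b else b).

Definition vsum (k : nat) (t : trie) (ws : seq (seq nat)) : seq trit :=
  foldr (fun w acc => if wordweight w == k then vadd (trie_find w t) acc else acc) [::] ws.

(** An unknown and its dual both carry the row of the inverse matrix attached to that unknown.
    Adding these rows over a relation yields a row of the product of the relation matrix with its
    claimed inverse, and the matrix itself is never formed. *)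
Definition make_trie (U : seq (seq nat)) (W : seq (seq trit)) : trie :=
  foldr (fun p t => trie_insert p.1 p.2 (trie_insert (dual p.1) p.2 t)) (Trie [::] [::])
        (zip U W).

Definition pivot_index (U : seq (seq nat)) (w : seq nat) : nat :=
  minn (index w U) (index (dual w) U).

(** The invariance of the weight under duality is settled by this finite check as well. *)
Definition check_table k U W (t : trie) : bool :=
  all (fun w => admw w ==>
    [&& wordweight (dual w) == k, veq (trie_find w t) (nth [::] W (pivot_index U w)) &
    [|| (pivot_index U w < size U)%N, w \in basis_words | dual w \in basis_words]])
    (words_of_weight k).

(** Left side minus right side must be the unit vector at the position of the relation: one row of
    the equation M W = 1. *)
Fixpoint check_relations k (t : trie) (rels : seq relation) i : bool :=
  if rels is r :: rels' then
    [&& admw r.1.1.1, admw r.1.1.2,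
      all (fun w => admw w && (wordweight w <= k)%N) (rel_left r ++ rel_right r),
      veq (vsum k t (rel_left r)) (vadd (vsum k t (rel_right r)) (vunit i)) &
      check_relations k t rels' i.+1]
  else true.

Definition check_weight k (rels : seq relation) (inv : seq positive) : bool :=
  let U := pivot_words k in
  let W := map trits_of_pos inv in
  let t := make_trie U W in
  [&& size U == size rels, size U == size W, check_table k U W t & check_relations k t rels 0].

(** The largest of the sampled degrees 0, ..., 90, 92. *)
Definition degree_bound := 92%N.

(** Multiplication by q^u / (1 - q^u) in blocks of length u: the recurrence r_n = r_(n-u) + l_(n-u)
    makes each new block the sum of the current block [c] and the next block of [l]. *)
Fixpoint chunk (fuel u : nat) (c l : seq trit) : seq trit :=
  if fuel is f.+1 then c ++ chunk f u (vadd c (take u l)) (drop u l) else [::].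

Definition zeta_mul u (l : seq trit) : seq trit :=
  if l is [::] then [::] else
  take degree_bound.+1 (chunk (degree_bound %/ u).+1 u (nseq u T0) l).

Fixpoint zeta_rows u (rows : seq (seq trit)) : seq (seq trit) :=
  if rows is l :: rows' then zeta_mul u l :: zeta_rows u.+1 rows' else [::].

Fixpoint prefix_rows acc (rows : seq (seq trit)) : seq (seq trit) :=
  if rows is l :: rows' then acc :: prefix_rows (vadd acc l) rows' else [::].

(** Row i holds the iterated sum restricted to u_1 <= i. To prefix a letter s, row i is multiplied
    by z^s at u = i+1 and replaced by the sum of the rows strictly before it; the last row is the
    full sum. *)
Fixpoint coef_table (f k : nat) (w : seq nat) (rows : seq (seq trit)) :
    seq (seq nat * seq trit) :=
  (w, last [::] rows) ::
    if f is f'.+1 then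
      flatten [seq coef_table f' (k - s) (s :: w) (prefix_rows [::] (iter s (zeta_rows 1) rows))
              | s <- [:: 1; 2; 3]%N & (s <= k)%N]
    else [::].

Definition basis_coefs : seq (seq trit) :=
  [seq x.2 | x <- coef_table 7 7 [::] (nseq degree_bound.+1 [:: T1]) &
             x.1 \notin redundant_words].

Definition lincomb (cs : seq trit) (W : seq (seq trit)) : seq trit :=
  foldr (fun p acc => match p.1 with
                      | T0 => acc
                      | T1 => vadd p.2 acc
                      | T2 => vadd (vopp p.2) acc
                      end) [::] (zip cs W).

Fixpoint check_rows (cs W : seq (seq trit)) (degs : seq nat) i : bool :=
  if degs is n :: degs' then
    [&& (n <= degree_bound)%N, veq (lincomb [seq nth T0 c n | c <- cs] W) (vunit i) &
      check_rows cs W degs' i.+1]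
  else true.

Definition check_independence : bool :=
  let cs := basis_coefs in
  let W := map trits_of_pos sample_inverse in
  [&& size cs == size sample_degrees, size W == size sample_degrees &
    check_rows cs W sample_degrees 0].

(** * All words of weight at most 7 *)

Definition trit_val (t : trit) : 'F_3 := match t with T0 => 0 | T1 => 1 | T2 => -1 end.

Definition vcoef (x : seq trit) (i : nat) : 'F_3 := trit_val (nth T0 x i).

Lemma trit_valD x y : trit_val (tadd x y) = trit_val x + trit_val y.
Proof. by apply/eqP; case: x y => -[]. Qed.

Lemma trit_valN x : trit_val (topp x) = - trit_val x.
Proof. by apply/eqP; case: x. Qed.

Lemma vcoef_nil i : vcoef [::] i = 0.
Proof. by rewrite /vcoef nth_nil. Qed.

Lemma vcoefD x y i : vcoef (vadd x y) i = vcoef x i + vcoef y i.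
Proof.
elim: x y i => [|a x IH] [|b y] i /=; rewrite ?vcoef_nil ?add0r ?addr0 //.
by case: i => [|i]; [exact: trit_valD | exact: IH].
Qed.

Lemma vcoefN x i : vcoef (vopp x) i = - vcoef x i.
Proof.
elim: x i => [|a x IH] [|i]; rewrite ?vcoef_nil ?oppr0 //; first exact: trit_valN.
exact: IH.
Qed.

Lemma vzeroP x i : vzero x -> vcoef x i = 0.
Proof.
elim: x i => [|a x IH] [|i] //=; rewrite ?vcoef_nil // => /andP[]; first by case: a.
by move=> _; apply: IH.
Qed.

Lemma veqP x y i : veq x y -> vcoef x i = vcoef y i.
Proof. by move=> /(vzeroP i)/eqP; rewrite vcoefD vcoefN subr_eq0 => /eqP. Qed.

Lemma vcoef_unit i j : vcoef (vunit i) j = (i == j)%:R.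
Proof.
by rewrite /vcoef /vunit; elim: i j => [|i IH] [|j] //=; rewrite nth_nil.
Qed.

Lemma mod3_det n (M : 'M[int]_n) (W : 'M['F_3]_n) :
  map_mx intr M *m W = 1%:M -> \det M != 0.
Proof.
move=> MW; apply/eqP => dM.
have : \det (map_mx intr M *m W) == 0 by rewrite det_mulmx det_map_mx dM mul0r.
by rewrite MW det1 oner_eq0.
Qed.

(** * Rational spans and linear systems *)

Lemma Qspan_ext S f g : f =1 g -> Qspan S f -> Qspan S g.
Proof. by move=> fg [m [c [h [Sh fE]]]]; exists m, c, h; split=> // n; rewrite -fg. Qed.

Lemma Qspan_gen (S : fps -> Prop) f : S f -> Qspan S f.
Proof.
move=> Sf; exists 1%N, (fun=> 1), (fun=> f); split=> // n.
by rewrite big_ord1 mul1r.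
Qed.

Lemma Qspan0 S : Qspan S (fun=> 0).
Proof. by exists 0%N, (fun=> 0), (fun=> fun=> 0); split=> [[]//|n]; rewrite big_ord0. Qed.

Lemma QspanD S f g : Qspan S f -> Qspan S g -> Qspan S (fun n => f n + g n).
Proof.
move=> [m [c [h [Sh fE]]]] [m' [c' [h' [Sh' gE]]]].
exists (m + m')%N, (fun i => match split i with inl j => c j | inr j => c' j end),
  (fun i => match split i with inl j => h j | inr j => h' j end).
split=> [i|n]; first by case: (split i).
rewrite fE gE big_split_ord /=; congr (_ + _); apply: eq_bigr => i _.
  by rewrite (unsplitK (inl i)).
by rewrite (unsplitK (inr i)).
Qed.

Lemma QspanZ S a f : Qspan S f -> Qspan S (fun n => a * f n).
Proof.
move=> [m [c [h [Sh fE]]]]; exists m, (fun i => a * c i), h; split=> // n.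
by rewrite fE mulr_sumr; apply: eq_bigr => i _; rewrite mulrA.
Qed.

Lemma QspanB S f g : Qspan S f -> Qspan S g -> Qspan S (fun n => f n - g n).
Proof.
move=> Sf Sg; apply: Qspan_ext (QspanD Sf (QspanZ (-1) Sg)) => n.
by rewrite mulN1r.
Qed.

Lemma Qspan_sum S I (r : seq I) (P : pred I) (c : I -> rat) (F : I -> fps) :
  (forall i, P i -> Qspan S (F i)) -> Qspan S (fun n => \sum_(i <- r | P i) c i * F i n).
Proof.
move=> SF; elim: r => [|i r IH].
  by apply: Qspan_ext (Qspan0 S) => n; rewrite big_nil.
case: (boolP (P i)) => Pi.
  by apply: Qspan_ext (QspanD (QspanZ (c i) (SF i Pi)) IH) => n; rewrite big_cons Pi.
by apply: Qspan_ext IH => n; rewrite big_cons (negbTE Pi).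
Qed.

Lemma Qspan_trans (S S' : fps -> Prop) f :
  (forall g, S g -> Qspan S' g) -> Qspan S f -> Qspan S' f.
Proof.
move=> SS' [m [c [h [Sh fE]]]].
have : Qspan S' (fun n => \sum_(i < m) c i * h i n).
  by apply: Qspan_sum => i _; apply: SS'.
by apply: Qspan_ext => n; rewrite fE.
Qed.

(** Cramer's rule: the adjugate of M times M is the scalar det M, invertible over the rationals. *)
Lemma Qspan_solve S n (M : 'M[int]_n) (x : 'I_n -> fps) :
  \det M != 0 ->
  (forall i, Qspan S (fun m => \sum_j (M i j)%:~R * x j m)) ->
  forall j, Qspan S (x j).
Proof.
move=> dM SM j.
have dM' : (\det M)%:~R != 0 :> rat by rewrite intr_eq0.
have : Qspan S (fun m => (\det M)%:~R^-1 *
    \sum_i ((\adj M) j i)%:~R * \sum_k (M i k)%:~R * x k m).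
  by apply: QspanZ; apply: Qspan_sum => i _; apply: SM.
apply: Qspan_ext => m; under eq_bigr do rewrite mulr_sumr.
rewrite exchange_big /=.
transitivity ((\det M)%:~R^-1 * \sum_k (((\adj M *m M) j k)%:~R * x k m)).
  congr (_ * _); apply: eq_bigr => k _; rewrite mxE raddf_sum mulr_suml.
  by apply: eq_bigr => i _; rewrite mulrA -intrM.
rewrite mul_adj_mx (bigD1 j) //= !mxE eqxx mulr1n big1 ?addr0 => [|k kj].
  by rewrite mulKf.
by rewrite mxE eq_sym (negbTE kj) mulr0n mul0r.
Qed.

(** The strict bound makes k = 0 the zero space, in step with the filtration at index k - 1. *)
Definition basis_fps (k : nat) (f : fps) : Prop :=
  exists2 w, (w \in basis_words) && (wordweight w < k)%N & f = wordfps w.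

Lemma basis_fps_leq k k' f : (k <= k')%N -> Qspan (basis_fps k) f -> Qspan (basis_fps k') f.
Proof.
move=> kk'; apply: Qspan_trans => _ [w /andP[wB wk] ->]; apply: Qspan_gen.
by exists w => //; rewrite wB (leq_trans wk).
Qed.

Lemma words_fuelS f k : words_fuel f.+1 k.+1 =
  flatten [seq [seq s :: w | w <- words_fuel f (k.+1 - maxn s 1)] | s <- iota 0 k.+2].
Proof. by []. Qed.

Lemma mem_words_fuel f w : (wordweight w <= f)%N -> w \in words_fuel f (wordweight w).
Proof.
elim: w f => [|s w IH] f; first by case: f.
have -> : wordweight (s :: w) = (maxn s 1 + wordweight w)%N by [].
move=> h.
have m0 : (0 < maxn s 1)%N by rewrite leq_max orbT.
case: f h => [|f]; first by rewrite leqn0 addn_eq0 eqn0Ngt m0.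
move=> h; have [k kE] : exists k, (maxn s 1 + wordweight w = k.+1)%N.
  by exists (maxn s 1 + wordweight w).-1; rewrite prednK // addn_gt0 m0.
rewrite kE words_fuelS.
apply/flatten_mapP; exists s.
  by rewrite mem_iota /= add0n ltnS -kE (leq_trans (leq_maxl s 1)) ?leq_addr.
apply/map_f; rewrite -kE addKn; apply: IH.
by rewrite -ltnS (leq_trans _ h) // -addn1 addnC leq_add2r.
Qed.

Lemma mem_words_of_weight w : w \in words_of_weight (wordweight w).
Proof. exact: mem_words_fuel. Qed.

(** * Soundness of the certificate for one weight *)

Section CheckWeight.

Variables (k : nat) (rels : seq relation) (inv : seq positive).
Hypothesis checked : check_weight k rels inv.
Hypothesis lower : forall w, admw w -> (wordweight w < k)%N -> Qspan (basis_fps k) (wordfps w).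

Let U := pivot_words k.
Let W := map trits_of_pos inv.
Let t := make_trie U W.
Let n := size U.
Let S := Qspan (basis_fps k.+1).

Let x (j : 'I_n) : fps := wordfps (nth [::] U j).

Let hits (j : nat) (w : seq nat) := (wordweight w == k) && (pivot_index U w == j).

Let good w := admw w && (wordweight w <= k)%N.

Let tableP w : admw w -> wordweight w = k ->
  [/\ wordweight (dual w) = k,
      forall i, vcoef (trie_find w t) i = vcoef (nth [::] W (pivot_index U w)) i &
  [|| (pivot_index U w < n)%N, w \in basis_words | dual w \in basis_words]].
Proof.
move=> aw wk; have /and4P[_ _ /allP tab _] := checked.
have := tab w; rewrite -wk mem_words_of_weight aw wk => /(_ isT) /=.
case/and3P => /eqP dk vE h; split=> // i; exact: veqP.
Qed.

Let vcoef_vsum ws i : all good ws ->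
  vcoef (vsum k t ws) i = \sum_(j < n) (count (hits j) ws)%:R * vcoef (nth [::] W j) i.
Proof.
have sW : size W = n by have /and4P[_ /eqP <- _ _] := checked.
elim: ws => [_|w ws IH /=].
  by rewrite vcoef_nil big1 // => j _; rewrite mul0r.
case/andP => /andP[aw wk] /IH {}IH.
have -> : \sum_(j < n) (hits j w + count (hits j) ws)%:R * vcoef (nth [::] W j) i =
    \sum_(j < n) (hits j w)%:R * vcoef (nth [::] W j) i + vcoef (vsum k t ws) i.
  by rewrite IH -big_split /=; apply: eq_bigr => j _; rewrite natrD mulrDl.
case: (eqVneq (wordweight w) k) => wE; last first.
  rewrite [X in _ = X + _]big1 ?add0r // => j _.
  by rewrite /hits (negbTE wE) mul0r.
have [_ vE _] := tableP aw wE.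
rewrite vcoefD vE; congr (_ + _); rewrite /hits wE eqxx /=.
case: (ltnP (pivot_index U w) n) => pn.
  rewrite (bigD1 (Ordinal pn)) //= eqxx mul1r big1 ?addr0 // => j ne.
  by rewrite eq_sym (_ : (_ == _ :> nat) = false) ?mul0r //; apply: negbTE.
(* For a basis word the index is out of range, and the default row is the zero vector. *)
rewrite nth_default ?sW // vcoef_nil big1 // => j _.
by rewrite gtn_eqF ?mul0r //; apply: leq_trans pn.
Qed.

(** Duality identifies a word with its pivot. Words of lower weight, and words that are basis words
    up to duality, vanish modulo [S]; these are the cases in which no [hits j] holds. *)
Let wordfps_class w : admw w -> (wordweight w <= k)%N ->
  S (fun m => wordfps w m - \sum_(j < n) (hits j w)%:R * x j m).
Proof.
move=> aw; rewrite leq_eqVlt => /orP[/eqP wE|wk]; last first.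
  apply: Qspan_ext (basis_fps_leq (leqnSn k) (lower aw wk)) => m.
  rewrite big1 ?subr0 // => j _.
  by rewrite /hits ltn_eqF ?mul0r.
have [dk _ cases] := tableP aw wE.
case: (ltnP (pivot_index U w) n) => pn.
  apply: Qspan_ext (Qspan0 _) => m.
  rewrite (bigD1 (Ordinal pn)) //= /hits wE !eqxx mul1r big1 => [|j ne]; last first.
    by rewrite eq_sym (_ : (_ == _ :> nat) = false) ?mul0r //; apply: negbTE.
  apply/esym/eqP; rewrite addr0 subr_eq0 /x /=; apply/eqP.
  have [e|e] : pivot_index U w = index w U \/ pivot_index U w = index (dual w) U.
  - by rewrite /pivot_index /minn; case: ifP; [left | right].
  - by rewrite e nth_index // -index_mem -e.
  by rewrite e nth_index -?index_mem -?e // wordfps_dual.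
have : wordfps w =1 (fun m => wordfps w m - \sum_(j < n) (hits j w)%:R * x j m).
  move=> m; rewrite big1 ?subr0 // => j _.
  rewrite /hits wE eqxx /= gtn_eqF ?mul0r //; exact: leq_trans pn.
move/Qspan_ext; apply; move: cases; rewrite ltnNge pn /= => /orP[wB|wB].
  by apply: Qspan_gen; exists w => //; rewrite wB wE /=.
apply: (@Qspan_ext _ (wordfps (dual w))); first exact: wordfps_dual.
by apply: Qspan_gen; exists (dual w) => //; rewrite wB dk /=.
Qed.

Let sum_classes ws : all good ws ->
  S (fun m => \sum_(w <- ws) wordfps w m - \sum_(j < n) (count (hits j) ws)%:R * x j m).
Proof.
elim: ws => [_|w ws IH /= /andP[/andP[aw wk] /IH {}IH]].
  apply: Qspan_ext (Qspan0 _) => m; rewrite big_nil big1 ?subr0 // => j _.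
  by rewrite mul0r.
apply: Qspan_ext (QspanD (wordfps_class aw wk) IH) => m.
have -> : \sum_(j < n) (hits j w + count (hits j) ws)%:R * x j m =
    \sum_(j < n) (hits j w)%:R * x j m + \sum_(j < n) (count (hits j) ws)%:R * x j m.
  by rewrite -big_split /=; apply: eq_bigr => j _; rewrite natrD mulrDl.
by rewrite big_cons opprD addrACA.
Qed.

Let relationP i : (i < n)%N ->
  let r := nth ([::], [::], false, false) rels i in
  [/\ all good (rel_left r), all good (rel_right r),
     forall m, \sum_(w <- rel_left r) wordfps w m = \sum_(w <- rel_right r) wordfps w m &
     forall j, vcoef (vsum k t (rel_left r)) j = vcoef (vsum k t (rel_right r)) j + (i == j)%:R].
Proof.
have /and4P[/eqP sR _ _] := checked; rewrite -/U -/n in sR; rewrite sR.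
(* The counter of unit vectors is generalised, since it moves along with the list of relations. *)
suff : forall i0, check_relations k t rels i0 -> (i < size rels)%N ->
  let r := nth ([::], [::], false, false) rels i in
  [/\ all good (rel_left r), all good (rel_right r),
     forall m, \sum_(w <- rel_left r) wordfps w m = \sum_(w <- rel_right r) wordfps w m &
     forall j, vcoef (vsum k t (rel_left r)) j =
       vcoef (vsum k t (rel_right r)) j + (i0 + i == j)%N%:R].
  by move=> h c; apply: (h 0%N c).
elim: {sR}rels i => [//|r rs IH] [|i] i0 /= /and5P[aa ab]; rewrite all_cat.
  move=> /andP[gl gr] ve _ _; split=> // [m|j]; last first.
    by rewrite (veqP j ve) vcoefD vcoef_unit addn0.
  case: r aa ab {gl gr ve} => [[[a b] da] db] /= aa ab.
  by apply: wordfps_stuffle => //; [case: da | case: db]; rewrite !inE eqxx ?orbT.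
by move=> _ _ cr ri; rewrite -addSnnS; apply: IH.
Qed.

Lemma check_weight_sound w : admw w -> (wordweight w <= k)%N ->
  Qspan (basis_fps k.+1) (wordfps w).
Proof.
pose r i := nth ([::], [::], false, false) rels i.
pose c ws (j : 'I_n) : int := (count (hits j) ws)%:Z.
pose M : 'M[int]_n := \matrix_(i, j) (c (rel_left (r i)) j - c (rel_right (r i)) j).
have dM : \det M != 0.
  apply: (@mod3_det _ _ (\matrix_(i, j) vcoef (nth [::] W i) j)).
  apply/matrixP => i j; rewrite !mxE.
  have [gl gr _ /(_ j)] := relationP (ltn_ord i).
  rewrite !vcoef_vsum // => /eqP; rewrite addrC -subr_eq -sumrB => /eqP <-.
  by apply: eq_bigr => l _; rewrite !mxE rmorphB /= mulrBl.
have Sx : forall j, S (x j).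
  apply: Qspan_solve dM _ => i; have [gl gr eqs _] := relationP (ltn_ord i).
  (* Both sides of the relation are the same series, so the difference of their two congruences
     modulo [S] leaves a row of M applied to the unknowns. *)
  apply: Qspan_ext (QspanB (sum_classes gr) (sum_classes gl)) => m.
  rewrite eqs opprB addrC addrA subrK -sumrB; apply: eq_bigr => j _.
  by rewrite !mxE rmorphB /= mulrBl.
move=> aw wk.
apply: Qspan_ext (QspanD (wordfps_class aw wk)
   (@Qspan_sum _ _ (index_enum 'I_n) xpredT (fun j => (hits j w)%:R) _ (fun j _ => Sx j))) => m.
by rewrite subrK.
Qed.

End CheckWeight.

Lemma basis_spans k w : (k <= 8)%N -> admw w -> (wordweight w < k)%N ->
  Qspan (basis_fps k) (wordfps w).
Proof.
move=> + aw; elim: k w aw => [//|k IH] w aw k8 wk.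
have [rels [inv chk]] : exists rels inv, check_weight k rels inv.
  move: k8 {IH wk}; case: k => [|[|[|[|[|[|[|[|//]]]]]]]] _.
  (* In weights 0, 1 and 2 there are no unknowns: each admissible word is a basis word up to
     duality. *)
  - by exists [::], [::]; vm_cast_no_check (erefl true).
  - by exists [::], [::]; vm_cast_no_check (erefl true).
  - by exists [::], [::]; vm_cast_no_check (erefl true).
  - by exists relations3, inverse3; vm_cast_no_check (erefl true).
  - by exists relations4, inverse4; vm_cast_no_check (erefl true).
  - by exists relations5, inverse5; vm_cast_no_check (erefl true).
  - by exists relations6, inverse6; vm_cast_no_check (erefl true).
  - by exists relations7, inverse7; vm_cast_no_check (erefl true).
by apply: (check_weight_sound chk) => // v av vk; apply: IH => //; apply: ltnW.
Qed.

(** * Independence of the basis words *)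

Lemma size_vadd x y : size (vadd x y) = maxn (size x) (size y).
Proof.
elim: x y => [|a x IH] [|b y] /=; rewrite ?maxn0 ?max0n //.
by rewrite IH maxnSS.
Qed.

(** The cut series satisfies Z = X^u (1 + Z) - X^(u(N+1)), and the correction lies beyond degree N.
    This is the recurrence behind [chunk]. *)
Lemma coef_zeta_mul (R : comNzRingType) N u (p : {poly R}) n : (0 < u)%N -> (n <= N)%N ->
  (zeta 'X N u * p)`_n =
  if (n < u)%N then 0 else p`_(n - u) + (zeta 'X N u * p)`_(n - u).
Proof.
move=> u0 nN.
have zE : zeta ('X : {poly R}) N u = 'X^u * (1 + zeta 'X N u) - 'X^(u * N.+1).
  rewrite mulrDr mulr1 /zeta mulr_sumr; apply: (canRL (addrK _)).
  rewrite -(big_nat_recr N.+1 1 (fun v => 'X^(u * v))) //= big_ltn // muln1 big_add1 /=.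
  by congr (_ + _); apply: eq_bigr => v _; rewrite -exprD mulnS.
rewrite [in LHS]zE mulrBl -mulrA mulrDl mul1r coefB !coefXnM coefD.
rewrite (_ : (n < u * N.+1)%N) ?subr0 //.
by apply: leq_trans (leq_pmull _ u0).
Qed.

Lemma coef_chunk fuel u c l n : size c = u -> (n < u * fuel)%N ->
  vcoef (chunk fuel u c l) n =
  if (n < u)%N then vcoef c n else vcoef l (n - u) + vcoef (chunk fuel u c l) (n - u).
Proof.
elim: fuel c l n => [|f IH] c l n sc; first by rewrite muln0.
rewrite mulnS => nf /=; set r := chunk f u _ _.
have catE m : vcoef (c ++ r) m = if (m < u)%N then vcoef c m else vcoef r (m - u).
  by rewrite /vcoef nth_cat sc; case: ifP.
rewrite catE; case: ltnP => // un; rewrite catE.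
have sc' : size (vadd c (take u l)) = u.
  by rewrite size_vadd sc; apply/maxn_idPl; rewrite size_take; case: ltnP.
rewrite {1}/r IH // -/r; last by rewrite ltn_subLR.
case: ltnP => mu; first by rewrite vcoefD addrC /vcoef nth_take.
by rewrite /vcoef nth_drop subnKC.
Qed.

Lemma coef_zeta_mulP u l (p : {poly 'F_3}) : (0 < u)%N ->
  (forall n, (n <= degree_bound)%N -> vcoef l n = p`_n) ->
  forall n, (n <= degree_bound)%N -> vcoef (zeta_mul u l) n = (zeta 'X degree_bound u * p)`_n.
Proof.
move=> u0 lp n nN.
have fuelE : (degree_bound < u * (degree_bound %/ u).+1)%N by rewrite mulnC ltn_ceil.
rewrite /zeta_mul; case: l lp => [|a l] lp.
  rewrite vcoef_nil; elim/ltn_ind: n nN => n IH nN.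
  rewrite coef_zeta_mul //; case: ltnP => // un.
  have nuN : (n - u <= degree_bound)%N by apply: leq_trans nN; apply: leq_subr.
  by rewrite -lp // vcoef_nil add0r -IH // ltn_subrL u0 (leq_trans u0).
rewrite /vcoef nth_take // -/(vcoef _ _).
move: (a :: l) lp => {a}l lp; elim/ltn_ind: n nN => n IH nN.
rewrite coef_zeta_mul // coef_chunk ?size_nseq //; last exact: leq_ltn_trans fuelE.
case: ltnP => un; first by rewrite /vcoef nth_nseq un.
have nuN : (n - u <= degree_bound)%N by apply: leq_trans nN; apply: leq_subr.
by rewrite lp // IH // ltn_subrL u0 (leq_trans u0).
Qed.

Lemma size_zeta_rows u rows : size (zeta_rows u rows) = size rows.
Proof. by elim: rows u => //= l rows IH u; rewrite IH. Qed.

Lemma nth_zeta_rows u rows i : (i < size rows)%N ->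
  nth [::] (zeta_rows u rows) i = zeta_mul (u + i) (nth [::] rows i).
Proof.
elim: rows u i => [//|l rows IH] u [|i] /= ir; first by rewrite addn0.
by rewrite IH // addSnnS.
Qed.

Lemma size_prefix_rows acc rows : size (prefix_rows acc rows) = size rows.
Proof. by elim: rows acc => //= l rows IH acc; rewrite IH. Qed.

Lemma nth_prefix_rows acc rows i n : (i < size rows)%N ->
  vcoef (nth [::] (prefix_rows acc rows) i) n =
  vcoef acc n + \sum_(j < i) vcoef (nth [::] rows j) n.
Proof.
elim: rows acc i => [//|l rows IH] acc [|i] /= ir; first by rewrite big_ord0 addr0.
by rewrite IH // vcoefD big_ord_recl addrA.
Qed.

Definition wordsum3 w m : {poly 'F_3} := wordsum 'X degree_bound w 1 m.

Definition rows_spec w (rows : seq (seq trit)) : Prop :=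
  size rows = degree_bound.+1 /\
  forall i n, (i <= degree_bound)%N -> (n <= degree_bound)%N ->
    vcoef (nth [::] rows i) n = (wordsum3 w i.+1)`_n.

Lemma rows_spec_nil : rows_spec [::] (nseq degree_bound.+1 [:: T1]).
Proof.
split=> [|i n iN nN]; first exact: size_nseq.
by rewrite nth_nseq ltnS iN coefC; case: n nN => [|[]].
Qed.

Lemma rows_spec_cons s w rows : rows_spec w rows ->
  rows_spec (s :: w) (prefix_rows [::] (iter s (zeta_rows 1) rows)).
Proof.
move=> [sr rE].
have [si iE] : size (iter s (zeta_rows 1) rows) = degree_bound.+1 /\
    forall i n, (i <= degree_bound)%N -> (n <= degree_bound)%N ->
      vcoef (nth [::] (iter s (zeta_rows 1) rows) i) n =
      (zeta 'X degree_bound i.+1 ^+ s * wordsum3 w i.+1)`_n.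
  elim: s => [|s [sI iI]] /=; first by split=> // i n iN nN; rewrite mul1r rE.
  split=> [|i n iN nN]; first by rewrite size_zeta_rows.
  rewrite nth_zeta_rows ?sI // exprS -mulrA add1n.
  by apply: coef_zeta_mulP => // m mN; apply: iI.
split=> [|i n iN nN]; first by rewrite size_prefix_rows.
rewrite nth_prefix_rows ?si // vcoef_nil add0r /wordsum3 wordsum_cons coef_sum.
rewrite big_add1 big_mkord; apply: eq_bigr => j _; apply: iE => //.
by rewrite (leq_trans (ltnW (ltn_ord j))).
Qed.

Lemma coef_tableS f k w rows : coef_table f.+1 k w rows = (w, last [::] rows) ::
  flatten [seq coef_table f (k - s) (s :: w) (prefix_rows [::] (iter s (zeta_rows 1) rows))
          | s <- [:: 1; 2; 3]%N & (s <= k)%N].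
Proof. by []. Qed.

Lemma words123S f k w : words123 f.+1 k w =
  w :: flatten [seq words123 f (k - s) (s :: w) | s <- [:: 1; 2; 3]%N & (s <= k)%N].
Proof. by []. Qed.

Lemma coef_table_spec f k w rows x : rows_spec w rows -> x \in coef_table f k w rows ->
  forall n, (n <= degree_bound)%N -> vcoef x.2 n = (wordsum3 x.1 degree_bound.+1)`_n.
Proof.
elim: f k w rows => [|f IH] k w rows wr.
  rewrite inE => /eqP -> n nN; have [sr rE] := wr.
  by rewrite /= -nth_last sr rE.
rewrite coef_tableS inE => /orP[/eqP -> n nN|].
  by have [sr rE] := wr; rewrite /= -nth_last sr rE.
by case/flatten_mapP => s _; apply: IH; apply: rows_spec_cons.
Qed.

Lemma coef_table_words f k w rows : [seq x.1 | x <- coef_table f k w rows] = words123 f k w.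
Proof.
elim: f k w rows => [//|f IH] k w rows.
rewrite coef_tableS words123S map_cons; congr (_ :: _).
rewrite map_flatten -map_comp; congr flatten.
by apply: eq_map => s /=; rewrite IH.
Qed.

Lemma basis_coefsP i n : (i < size basis_words)%N -> (n <= degree_bound)%N ->
  vcoef (nth [::] basis_coefs i) n = (wordsum3 (nth [::] basis_words i) degree_bound.+1)`_n.
Proof.
set rows := nseq degree_bound.+1 [:: T1].
pose tab := [seq x <- coef_table 7 7 [::] rows | x.1 \notin redundant_words].
have tabP x : x \in tab -> forall n, (n <= degree_bound)%N ->
    vcoef x.2 n = (wordsum3 x.1 degree_bound.+1)`_n.
  by rewrite mem_filter => /andP[_]; apply: coef_table_spec; apply: rows_spec_nil.
have wE : basis_words = [seq x.1 | x <- tab].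
  by rewrite /basis_words -(coef_table_words 7 7 [::] rows) filter_map.
have cE : basis_coefs = [seq x.2 | x <- tab] by [].
(* The table becomes abstract here, so that nothing below evaluates it. *)
rewrite {}wE {}cE; clearbody tab; rewrite size_map => itab nN.
rewrite !(nth_map ([::], [::])) //; apply: tabP => //; exact: mem_nth.
Qed.

Lemma vcoef_lincomb cs W i : size W = size cs ->
  vcoef (lincomb cs W) i = \sum_(j < size cs) trit_val (nth T0 cs j) * vcoef (nth [::] W j) i.
Proof.
elim: cs W => [|c cs IH] [|w W] //= => [_|[sW]]; first by rewrite big_ord0 vcoef_nil.
rewrite big_ord_recl /= -IH //; case: c; rewrite /= ?mul0r ?add0r ?mul1r ?mulN1r //.
  by rewrite vcoefD.
by rewrite vcoefD vcoefN.
Qed.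

Lemma check_rowsP cs W degs i0 i : check_rows cs W degs i0 -> (i < size degs)%N ->
  (nth 0 degs i <= degree_bound)%N /\
  forall j, vcoef (lincomb [seq nth T0 c (nth 0%N degs i) | c <- cs] W) j = (i0 + i == j)%N%:R.
Proof.
elim: degs i i0 => [//|n degs IH] [|i] i0 /= /and3P[nN ve cr] ir.
  by split=> // j; rewrite (veqP j ve) vcoef_unit addn0.
by rewrite -addSnnS; apply: IH.
Qed.

(** A linear relation among the series gives a vector killed by the integer matrix of sampled
    coefficients; that matrix has an inverse modulo 3, so it is invertible over the rationals. *)
Lemma check_rows_independent (ws : seq (seq nat)) (cs W : seq (seq trit)) (degs : seq nat) :
    all admw ws -> size ws = size degs -> size cs = size degs -> size W = size degs ->
    check_rows cs W degs 0 ->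
    (forall i n, (i < size ws)%N -> (n <= degree_bound)%N ->
      vcoef (nth [::] cs i) n = (wordsum3 (nth [::] ws i) degree_bound.+1)`_n) ->
  forall c : seq nat -> rat, (forall n, \sum_(w <- ws) c w * wordfps w n = 0) ->
  forall w, w \in ws -> c w = 0.
Proof.
move=> /allP aw sb sc sW chk csE c c0; pose b i := nth [::] ws i.
pose deg i := nth 0%N degs i.
pose M : 'M[int]_(size degs) := \matrix_(i, j)
  (wordsum 'X degree_bound (b j) 1 degree_bound.+1 : {poly int})`_(deg i).
have dM : \det M != 0.
  apply: (@mod3_det _ _ (\matrix_(i, j) vcoef (nth [::] W i) j)).
  apply/matrixP => i j; rewrite !mxE.
  have [degN /(_ j)] := check_rowsP chk (ltn_ord i).
  rewrite vcoef_lincomb size_map sc // => <-; apply: eq_bigr => k _.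
  rewrite !mxE; congr (_ * _).
  rewrite (nth_map [::]) ?sc // -/(vcoef _ _) csE ?sb //.
  by rewrite -coef_map rmorph_wordsum /= map_polyX.
have M0 : map_mx (intr : int -> rat) M *m \col_(j < size degs) c (b j) = 0.
  apply/matrixP => i z; rewrite !mxE -[RHS](c0 (deg i)) (big_nth [::]) big_mkord sb.
  apply: eq_bigr => j _; rewrite !mxE mulrC; congr (_ * _).
  have [degN _] := check_rowsP chk (ltn_ord i).
  by rewrite (wordfps_poly (N := degree_bound)) // aw // mem_nth ?sb.
have cM : \col_(j < size degs) c (b j) = 0.
  have uM : map_mx (intr : int -> rat) M \in unitmx.
    by rewrite unitmxE det_map_mx unitfE intr_eq0.
  by rewrite -[LHS](mulKmx uM) M0 mulmx0.
move=> w wB; have iw : (index w ws < size degs)%N by rewrite -sb index_mem.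
have := congr1 (fun X : 'cV_ _ => X (Ordinal iw) 0) cM.
by rewrite !mxE /b /= nth_index.
Qed.

Lemma basis_independent (c : seq nat -> rat) :
  (forall n, \sum_(w <- basis_words) c w * wordfps w n = 0) ->
  forall w, w \in basis_words -> c w = 0.
Proof.
have chk : check_independence by vm_cast_no_check (erefl true).
have aw : all admw basis_words by vm_cast_no_check (erefl true).
have sb : size basis_words = size sample_degrees by vm_cast_no_check (erefl (size sample_degrees)).
case/and3P: chk => /eqP sc /eqP sW chk.
exact: (check_rows_independent aw sb sc sW chk basis_coefsP).
Qed.

(** * The weight filtration *)

Definition lastfps (F : truncfam) : fps := fun n => lastcoef (F n n.+1).

Lemma Qspan_lastfps G (P : pred (seq nat)) F S :
  (forall w, P w -> Qspan S (lastfps (G w))) -> spanned G P F -> Qspan S (lastfps F).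
Proof.
move=> GS [c Pc cE].
apply: (Qspan_ext (f := fun n => \sum_(x <- c | P x.2) x.1 * lastfps (G x.2) n)).
  move=> n; rewrite /lastfps cE // lastcoef_sum big_seq_cond [RHS]big_seq; apply: eq_big => x.
    by rewrite andb_idr // => /(allP Pc).
  by rewrite lastcoefZ.
by apply: Qspan_sum => x; apply: GS.
Qed.

Lemma sum_tuple l (s : l.-tuple nat) : (\sum_j tnth s j = sumn s)%N.
Proof. by rewrite sumnE (seq_ofE s) big_map big_enum. Qed.

Lemma weightE l (s r : l.-tuple nat) : weight s r = sumn [seq x.1 + x.2 | x <- zip s r]%N.
Proof.
rewrite /weight -big_split /= sumnE big_map.
have -> : zip s r = [seq (tnth s j, tnth r j) | j <- enum 'I_l].
  by rewrite (seq_ofE s) (seq_ofE r); elim: (enum 'I_l) => //= j e ->.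
by rewrite big_map big_enum.
Qed.

(** This makes the depth condition in the filtration a consequence of the weight condition. *)
Lemma admissible_leq_weight l (s r : l.-tuple nat) : admissible s -> (l <= weight s r)%N.
Proof.
move=> /forallP s1; rewrite /weight -[X in (X <= _)%N]card_ord -sum1_card.
by apply: leq_trans (leq_addr _ _); apply: leq_sum => j _; apply: s1.
Qed.

Lemma bibracket_basis k l (s r : l.-tuple nat) : (k <= 8)%N ->
  admissible s -> (weight s r < k)%N -> Qspan (basis_fps k) (bibracket s r).
Proof.
move=> k8 s1 wk; apply: (Qspan_ext (f := lastfps (bifam (zip s r)))).
  by move=> n; rewrite bibracketE.
apply: Qspan_lastfps (bifam_spanned _) => [w /andP[aw ww]|].
  by apply: basis_spans => //; apply: leq_ltn_trans ww _; rewrite -weightE.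
apply/allP => -[x y] /(map_f fst); rewrite -/(unzip1 _) unzip1_zip ?size_tuple //=.
by case/tnthP => j ->; apply: (forallP s1).
Qed.

Lemma zip_zero_row (v : seq nat) :
  zip v [tuple 0%N | _ < size v] = [seq (s, 0%N) | s <- v].
Proof.
have -> : tval [tuple 0%N | _ < size v] = nseq (size v) 0%N.
  apply: (@eq_from_nth _ 0%N); rewrite ?size_tuple ?size_nseq // => i iv.
  by rewrite nth_nseq iv -[i]/(nat_of_ord (Ordinal iv)) -tnth_nth tnth_mktuple.
by elim: v => //= s v ->.
Qed.

Lemma bracketfam_bracket (v : seq nat) : lastfps (bracketfam v) =1 bracket (in_tuple v).
Proof.
by move=> n; rewrite /bracket bibracketE /= zip_zero_row.
Qed.

Lemma basis_word123 w : w \in basis_words -> all (fun s => s \in [:: 1; 2; 3]%N) w.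
Proof.
have : all (fun w => all (fun s => s \in [:: 1; 2; 3]%N) w) basis_words by vm_compute.
by move/allP; apply.
Qed.

(** The target [S] is left open to serve both the filtration, where the weight bound matters, and
    the span of all 123-brackets. *)
Lemma basis_brackets S w : w \in basis_words ->
  (forall v : seq nat, all (fun s => s \in [:: 1; 2; 3]%N) v -> (sumn v <= wordweight w)%N ->
     Qspan S (bracket (in_tuple v))) ->
  Qspan S (wordfps w).
Proof.
move=> /basis_word123 w123 Sv.
apply: Qspan_lastfps (word123_spanned w123) => v /andP[v123 vw].
apply: Qspan_ext (Sv v v123 vw) => n.
by rewrite bracketfam_bracket.
Qed.

Lemma admissible123 (v : seq nat) :
  all (fun s => s \in [:: 1; 2; 3]%N) v -> admissible (in_tuple v).
Proof.
move=> /allP v123; apply/forallP => j; have := v123 _ (mem_tnth j (in_tuple v)).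
by rewrite !inE => /or3P[] /eqP ->.
Qed.

Lemma bracket_weightE l (s : l.-tuple nat) : bracket_weight s = sumn s.
Proof.
rewrite /bracket_weight /weight sum_tuple [X in (_ + X)%N]big1 ?addn0 // => j _.
exact: tnth_mktuple.
Qed.

Lemma FilW_basis (k : nat) f : (k <= 8)%N ->
  FilW (k%:Z - 1) f <-> Qspan (basis_fps k) f.
Proof.
move=> k8; have ltE m : (m%:Z <= k%:Z - 1) = (m < k)%N.
  by rewrite lerBrDr -[1]/(1%:Z) -PoszD addn1 lez_nat.
split; apply: Qspan_trans => g.
  by case=> l [s [r [s1 _ wk ->]]]; apply: bibracket_basis; rewrite // -ltE.
case=> w /andP[wB wk] ->; apply: basis_brackets => // v v123 vw.
have av := admissible123 v123.
have vk : (bracket_weight (in_tuple v) < k)%N by rewrite bracket_weightE (leq_ltn_trans vw).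
apply: Qspan_gen; exists (size v), (in_tuple v), [tuple 0%N | _ < size v].
split=> //; rewrite ltE //.
exact: leq_ltn_trans (admissible_leq_weight _ av) vk.
Qed.

Lemma basis_fps_coefs k f : Qspan (basis_fps k) f ->
  exists c : seq nat -> rat,
    f =1 fun n => \sum_(w <- basis_words | (wordweight w < k)%N) c w * wordfps w n.
Proof.
have uB : uniq basis_words by vm_compute.
(* The concrete list is replaced by an arbitrary duplicate-free one, which keeps it from being
   unfolded. *)
rewrite /basis_fps; move: basis_words uB => ws uB.
case=> m [c [g [gB fE]]].
have : exists c' : seq nat -> rat, (fun n => \sum_(i < m) c i * g i n) =1
    (fun n => \sum_(w <- ws | (wordweight w < k)%N) c' w * wordfps w n).
  elim: m c g gB {fE} => [|m IH] c g gB.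
    by exists (fun=> 0) => n; rewrite big_ord0 big1 // => w _; rewrite mul0r.
  have [c' cE] := IH (fun i => c (lift ord0 i)) (fun i => g (lift ord0 i)) (fun i => gB _).
  have [w /andP[wB wk] gE] := gB ord0.
  (* Several generators may be the same word, so coefficients accumulate on words. *)
  exists (fun v => c' v + (if v == w then c ord0 else 0)) => n.
  under [RHS]eq_bigr do rewrite mulrDl.
  rewrite big_split -cE big_ord_recl addrC gE /=; congr (_ + _).
  rewrite -big_filter (bigD1_seq w) ?mem_filter ?wk ?filter_uniq //= eqxx.
  by rewrite big1 ?addr0 // => v vw; rewrite (negbTE vw) mul0r.
by case=> c' cE; exists c' => n; rewrite fE -cE.
Qed.

Definition basis_of_weight k := [seq w <- basis_words | wordweight w == k].

(** The classes of the basis words of weight exactly k form a basis: they span by [FilW_basis] at k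
    + 1, and uniqueness comes from the independence of all basis words together. *)
Lemma dim_grW_basis k : (k <= 7)%N -> dim_grW k%:Z (size (basis_of_weight k)).
Proof.
move=> k7; set B := basis_of_weight k.
have uB : uniq B by apply: filter_uniq; vm_compute.
have Bk (i : 'I_(size B)) : (nth [::] B i \in basis_words) && (wordweight (nth [::] B i) == k).
  by have := mem_nth [::] (ltn_ord i); rewrite mem_filter andbC.
have kE : k%:Z = k.+1%:Z - 1 by rewrite -addn1 PoszD addrK.
have sumB (F : seq nat -> rat) :
    \sum_(i < size B) F (nth [::] B i) = \sum_(w <- basis_words | wordweight w == k) F w.
  by rewrite -[RHS]big_filter (big_nth [::]) big_mkord.
exists (fun i => wordfps (nth [::] B i)); split=> [i|f].
  rewrite kE; apply/FilW_basis => //; apply: Qspan_gen; exists (nth [::] B i) => //.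
  by case/andP: (Bk i) => -> /eqP -> /=.
rewrite {1}kE => /(FilW_basis _ (k7 : (k.+1 <= 8)%N)) /basis_fps_coefs[e eE].
have splitE (g : seq nat -> rat) : \sum_(w <- basis_words | (wordweight w < k.+1)%N) g w =
    \sum_(w <- basis_words | wordweight w == k) g w +
    \sum_(w <- basis_words | (wordweight w < k)%N) g w.
  rewrite (bigID (fun w => wordweight w == k)) /=; congr (_ + _); apply: eq_bigl => w.
    by rewrite andb_idl // => /eqP ->.
  by rewrite ltnS ltn_neqAle andbC.
exists [ffun i => e (nth [::] B (nat_of_ord i))]; split.
  apply/FilW_basis; first exact: leqW.
  apply: (Qspan_ext (f := fun n =>
      \sum_(w <- basis_words | (wordweight w < k)%N) e w * wordfps w n)).
    move=> n; rewrite eE splitE -(sumB (fun w => e w * wordfps w n)).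
    by under [X in _ - X]eq_bigr do rewrite ffunE; rewrite addrC addKr.
  apply: (Qspan_ext (f := fun n => \sum_(w <- basis_words |
      (w \in basis_words) && (wordweight w < k)%N) e w * wordfps w n)).
    by move=> n; rewrite [RHS]big_seq_cond.
  by apply: Qspan_sum => w wB; apply: Qspan_gen; exists w.
move=> c /(FilW_basis _ (leqW k7)) /basis_fps_coefs[e' e'E].
(* Here [h] carries [c] from positions back to words, and [g] is the difference of two expansions of
   f: the one with coefficients [e], and the one made of [h] in weight k and [e'] below. *)
pose h w : rat := if insub (index w B) is Some i then c i else 0.
have hE i : h (nth [::] B (nat_of_ord i)) = c i by rewrite /h index_uniq ?valK.
pose g w := if wordweight w == k then e w - h w else
  if (wordweight w < k)%N then e w - e' w else 0.
have g0 : forall w, w \in basis_words -> g w = 0.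
  apply: basis_independent => n.
  have lastE : \sum_(w <- basis_words | wordweight w == k) (e w - h w) * wordfps w n +
      \sum_(w <- basis_words | (wordweight w < k)%N) (e w - e' w) * wordfps w n = 0.
    have := e'E n; rewrite eE splitE => eq1.
    have hsum : \sum_(w <- basis_words | wordweight w == k) h w * wordfps w n =
        \sum_(i < size B) c i * wordfps (nth [::] B i) n.
      by rewrite -(sumB (fun w => h w * wordfps w n)); apply: eq_bigr => i _; rewrite hE.
    have sumBl (P : pred (seq nat)) (x y : seq nat -> rat) :
        \sum_(w <- basis_words | P w) (x w - y w) * wordfps w n =
        \sum_(w <- basis_words | P w) x w * wordfps w n -
        \sum_(w <- basis_words | P w) y w * wordfps w n.
      by rewrite -sumrB; apply: eq_bigr => w _; rewrite mulrBl.
    by rewrite !sumBl hsum -eq1; ring.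
  rewrite -[RHS]lastE (bigID (fun w => (wordweight w < k.+1)%N)) /= splitE.
  rewrite [X in _ + X]big1 ?addr0 => [|w]; last first.
    rewrite -leqNgt => kw; rewrite /g gtn_eqF // ltnNge (ltnW kw) mul0r //.
  congr (_ + _); apply: eq_bigr => w; rewrite /g; first by move=> ->.
  by move=> wk; rewrite ltn_eqF // wk.
apply/ffunP => i; rewrite ffunE -hE; case/andP: (Bk i) => /g0 + wk.
by rewrite /g wk => /eqP; rewrite subr_eq0 => /eqP.
Qed.

(** * The prescribed power series *)

Fixpoint reciprocal_coefs (D : {poly rat}) (n : nat) : seq rat :=
  if n is n'.+1 then
    let L := reciprocal_coefs D n' in
    rcons L ((n' == 0%N)%:R - \sum_(i < n') D`_i.+1 * L`_(n' - i.+1))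
  else [::].

(** With constant term 1, the equation in degree n can be solved for the n-th coefficient in terms
    of the earlier ones. *)
Lemma expansion_exists (D : {poly rat}) : D`_0 = 1 -> exists a : fps, is_expansion 1 D a.
Proof.
move=> D0.
have sz n : size (reciprocal_coefs D n) = n.
  by elim: n => //= n IH; rewrite size_rcons IH.
exists (fun n => (reciprocal_coefs D n.+1)`_n) => n.
have stable i j : (i < j)%N -> (reciprocal_coefs D j)`_i = (reciprocal_coefs D i.+1)`_i.
  elim: j => // j IH; rewrite ltnS leq_eqVlt => /orP[/eqP -> //|ij].
  by rewrite [in LHS]/= nth_rcons sz ij IH.
rewrite big_ord_recl D0 mul1r subn0 [X in X + _]/= nth_rcons sz ltnn eqxx.
rewrite coef1 [X in _ - X](eq_bigr (fun i : 'I_n =>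
    D`_(lift ord0 i) * (reciprocal_coefs D (n - lift ord0 i).+1)`_(n - lift ord0 i))) ?subrK //.
move=> i _; rewrite lift0 stable //; last by rewrite ltn_subrL (leq_trans _ (ltn_ord i)).
Qed.

Lemma expansion_dim (a : fps) k :
  is_expansion 1 (1 - 'X - 'X^2 - 'X^3 + 'X^6 + 'X^7 + 'X^8 + 'X^9 : {poly rat}) a ->
  (k <= 7)%N -> (size (basis_of_weight k))%:R = a k.
Proof.
move=> aE; have E n := aE n.
have sizes : [seq size (basis_of_weight i) | i <- iota 0 8] = [:: 1; 1; 2; 4; 7; 13; 23; 41]%N.
  by vm_compute.
have sE i : (i < 8)%N -> size (basis_of_weight i) = nth 0%N [:: 1; 1; 2; 4; 7; 13; 23; 41]%N i.
  by move=> i8; rewrite -sizes (nth_map 0%N) ?size_iota // nth_iota.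
have := E 0%N; have := E 1%N; have := E 2%N; have := E 3%N; have := E 4%N;
have := E 5%N; have := E 6%N; have := E 7%N.
rewrite !big_ord_recl !big_ord0 !lift0 !coefE /=.
rewrite !subSS !subn0.
move=> e7 e6 e5 e4 e3 e2 e1 e0.
by case: k => [|[|[|[|[|[|[|[|//]]]]]]]] _; rewrite sE //=; lra.
Qed.

Theorem mainTheorem4 :
  exists a : fps,
    is_expansion 1
      (1 - 'X - 'X^2 - 'X^3 + 'X^6 + 'X^7 + 'X^8 + 'X^9 : {poly rat}) a /\
    forall k : nat, (k <= 7)%N ->
      [/\ exists2 d : nat, dim_grW k%:Z d & d%:R = a k,
          forall (l : nat) (s r : l.-tuple nat),
            admissible s -> weight s r = k ->
            Qspan positive_bibrackets (bibracket s r),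
          forall (l : nat) (s r : l.-tuple nat),
            admissible s -> weight s r = k ->
            Qspan brackets (bibracket s r) &
          forall (l : nat) (s : l.-tuple nat),
            admissible s -> bracket_weight s = k ->
            Qspan brackets123 (bracket s)].
Proof.
have [|a aE] := @expansion_exists (1 - 'X - 'X^2 - 'X^3 + 'X^6 + 'X^7 + 'X^8 + 'X^9).
  by rewrite !coefE /= ?subr0 ?addr0.
exists a; split=> // k k7.
(* This yields (b), (c) and (d) together: a 123-bracket is a bracket, and a bracket is positive
   since s_j >= 1 > 0 = r_j. *)
have span123 l (s r : l.-tuple nat) : admissible s -> weight s r = k ->
    Qspan brackets123 (bibracket s r).
  move=> s1 wk; have : Qspan (basis_fps 8) (bibracket s r).
    by apply: bibracket_basis; rewrite // wk.
  apply: Qspan_trans => _ [w /andP[wB _] ->]; apply: basis_brackets => // v v123 _.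
  apply: Qspan_gen; exists (size v), (in_tuple v); split=> //.
  by apply/forallP => j; apply: (allP v123); apply: (mem_tnth j (in_tuple v)).
have adm123 l (s : l.-tuple nat) : [forall j, tnth s j \in [:: 1; 2; 3]%N] -> admissible s.
  by move=> /forallP s123; apply/forallP => j; have := s123 j; rewrite !inE => /or3P[] /eqP ->.
split.
- by exists (size (basis_of_weight k)); [exact: dim_grW_basis | exact: expansion_dim].
- move=> l s r s1 wk; apply: Qspan_trans (span123 l s r s1 wk) => _ [l' [s' [/adm123 as' ->]]].
  apply: Qspan_gen; exists l', s', [tuple 0%N | _ < l']; split=> //.
  by apply/forallP => j; rewrite tnth_mktuple; apply: (forallP as').
- move=> l s r s1 wk; apply: Qspan_trans (span123 l s r s1 wk) => _ [l' [s' [/adm123 as' ->]]].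
  by apply: Qspan_gen; exists l', s'.
by move=> l s s1 wk; apply: span123.
Qed.
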